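(* Let $\alpha>0$. Let $f_0\in C^1_{x,v}(T\mathbb{H}^2)$, $f_0:T\mathbb{H}^2\to[0,\infty)$, be an initial datum for the Vlasov equation on the hyperbolic plane $(\mathbb{H}^2,g_{\mathbb{H}^2})$ whose support is compact and contained in $\mathcal{D}_\alpha=\{(x,v)\in T\mathbb{H}^2: g_x(v,v)\ge \alpha^2\}$. Let $f:[0,\infty)\times T\mathbb{H}^2\to[0,\infty)$ be the corresponding solution of the Vlasov equation $\partial_t f+Xf=0$, $f(0,\cdot)=f_0$, and let $\rho(f)$ be its spatial density. Then there is a constant $C>0$, depending only on $\alpha$ and on the support of $f_0$, such that for every $t\ge 0$ and every $x\in\mathbb{H}^2$, $$|\rho(f)(t,x)|\le \frac{C}{\exp(\alpha t)}\|f_0\|_{L^\infty_{x,v}},$$ $$\Big|\frac{1}{\sinh r}\partial_\theta\rho(f)(t,x)\Big|\le \frac{C}{\exp(2\alpha t)}\|f_0\|_{W^{1,\infty}_{x,v}},\qquad |\partial_r\rho(f)(t,x)|\le \frac{C}{\exp(\alpha t)}\|f_0\|_{W^{1,\infty}_{x,v}},$$ where the derivative estimates are understood at points with $r>0$, where the polar frame is defined.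
   Context: $\mathbb{H}^2$ is hyperbolic space with geodesic polar coordinates $(r,\theta)$ in which $g=g_{\mathbb{H}^2}=\mathrm{d}r^2+\sinh^2 r\,\mathrm{d}\theta^2$; $(r,\theta,v^r,v^\theta)$ are the induced coordinates on $T\mathbb{H}^2$ (so $v=v^r\partial_r+v^\theta\partial_\theta$). $X$ is the generator of the geodesic flow $\phi_t$ on $T\mathbb{H}^2$, and the Vlasov equation reads $$\partial_t f+v^r\partial_r f+v^\theta\partial_\theta f+(v^\theta)^2\sinh r\cosh r\,\partial_{v^r}f-2v^rv^\theta\coth r\,\partial_{v^\theta}f=0,$$ equivalently $f(t,x,v)=f_0(\phi_{-t}(x,v))$. The spatial density is $\rho(f)(t,x)=\int_{T_x\mathbb{H}^2} f(t,x,v)\,\mathrm{dvol}_{T_x\mathbb{H}^2}(v)=\int f(t,x,v)\sinh r\,\mathrm{d}v^r\mathrm{d}v^\theta$. $\|f_0\|_{L^\infty_{x,v}}$ is the supremum of $|f_0|$ and $\|f_0\|_{W^{1,\infty}_{x,v}}$ is the supremum of $|f_0|$ plus the supremum of the norm of its first-order derivatives on $T\mathbb{H}^2$ (measured with the Sasaki metric on $T\mathbb{H}^2$). *)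

(* Defs.v *)
From HB Require Import structures.
From mathcomp Require Import all_boot all_order all_algebra.
From mathcomp Require Import all_classical all_reals all_analysis.
From mathcomp Require Import ring lra.

Set Implicit Arguments.
Unset Strict Implicit.
Unset Printing Implicit Defensive.

Import Order.TTheory GRing.Theory Num.Theory.
Import numFieldNormedType.Exports.

Local Open Scope classical_set_scope.
Local Open Scope ring_scope.

(* The hyperbolic plane is the hyperboloid [y0^2 = 1 + y1^2 + y2^2, y0 > 0] of
   Minkowski space, in its global chart [(y1, y2)].  This chart identifies H^2
   with [R * R] and TH^2 with [(R * R) * (R * R)], so that C^1 on TH^2 is C^1 in
   these coordinates, also at the origin [r = 0] of the polar coordinates. *)

Section HyperbolicPlane.
Variable R : realType.
Implicit Types (r th : R) (x u v w : R * R) (z : (R * R) * (R * R)).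

Definition cosh r : R := (expR r + expR (- r)) / 2.
Definition sinh r : R := (expR r - expR (- r)) / 2.

Definition dot u w : R := u.1 * w.1 + u.2 * w.2.

(* The restriction of the Minkowski form [- dy0^2 + dy1^2 + dy2^2]; see
   [gH_polar] for its form in polar coordinates. *)
Definition gH x u w : R := dot u w - dot x u * dot x w / (1 + dot x x).

(* Levi-Civita connection of [gH] in the chart; see [christoffel_koszul]. *)
Definition christoffel x u w : R * R := - gH x u w *: x.

Definition polar r th : R * R := (sinh r * cos th, sinh r * sin th).

Definition polar_dr r th : R * R := (cosh r * cos th, cosh r * sin th).
Definition polar_dth r th : R * R := (- (sinh r * sin th), sinh r * cos th).

Definition polar_vec r th vr vth : R * R :=
  vr *: polar_dr r th + vth *: polar_dth r th.

(* The generator of the geodesic flow, as a vector field on TH^2; see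
   [geodesic_field_polar] for its form in polar coordinates. *)
Definition geodesic_field z : (R * R) * (R * R) :=
  (z.2, - christoffel z.1 z.2 z.2).

(* Horizontal part [xi.1], vertical part [xi.2 + christoffel z.1 z.2 xi.1]. *)
Definition sasaki z (xi eta : (R * R) * (R * R)) : R :=
  gH z.1 xi.1 eta.1
  + gH z.1 (xi.2 + christoffel z.1 z.2 xi.1)
           (eta.2 + christoffel z.1 z.2 eta.1).

Definition C1 (V W : normedModType R) (D : set V) (F : V -> W) : Prop :=
  forall p, D p -> differentiable F p /\
    forall a : V, {for p, continuous (fun q => 'D_a F q)}.

Definition supp (f : (R * R) * (R * R) -> R) : set ((R * R) * (R * R)) :=
  closure [set z | f z != 0].

Definition region (alpha : R) : set ((R * R) * (R * R)) :=
  [set z | alpha ^+ 2 <= gH z.1 z.2 z.2].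

(* The real-valued suprema below are genuine for the compactly supported C^1
   functions they are applied to (the sets are then nonempty and bounded). *)
Definition norm_Linfty (f : (R * R) * (R * R) -> R) : R :=
  sup (range (fun z => `|f z|)).

Definition sasaki_dnorm (f : (R * R) * (R * R) -> R) z : R :=
  sup [set `|'D_xi f z| | xi in [set xi | sasaki z xi xi <= 1]].

Definition norm_W1infty (f : (R * R) * (R * R) -> R) : R :=
  norm_Linfty f + sup (range (sasaki_dnorm f)).

(* Classical solutions: C^1 for [t > 0], continuous up to [t = 0]. *)
Definition vlasov_solution (f0 : (R * R) * (R * R) -> R)
    (f : R -> (R * R) * (R * R) -> R) : Prop :=
  [/\ f 0 = f0,
      forall t z, 0 <= t -> 0 <= f t z,
      {within [set p : R * ((R * R) * (R * R)) | 0 <= p.1],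
        continuous (fun p => f p.1 p.2)},
      C1 [set p : R * ((R * R) * (R * R)) | 0 < p.1] (fun p => f p.1 p.2) &
      forall t z, 0 < t ->
        'D_1 (fun s : R => f s z) t + 'D_(geodesic_field z) (f t) z = 0].

Definition vol_density x : R :=
  Num.sqrt (gH x (1, 0) (1, 0) * gH x (0, 1) (0, 1) - gH x (1, 0) (0, 1) ^+ 2).

Definition rho (f : (R * R) * (R * R) -> R) x : R :=
  \int[(@lebesgue_measure R \x @lebesgue_measure R)%E]_v
    (f (x, v) * vol_density x).

Lemma cosh_gt0 r : 0 < cosh r.
Proof. by rewrite divr_gt0// addr_gt0// expR_gt0. Qed.

Lemma cosh2_sinh2 r : cosh r ^+ 2 = 1 + sinh r ^+ 2.
Proof.
have E : expR r * expR (- r) = 1 by rewrite -expRD subrr expR0.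
rewrite /cosh /sinh; move: (expR r) (expR (- r)) E => a b E.
transitivity (a * b + ((a - b) / 2) ^+ 2); first by field.
by rewrite E.
Qed.

Lemma is_derive_expRN r : is_derive r 1 (fun s => expR (- s) : R) (- expR (- r)).
Proof.
have H : is_derive r 1 (-%R : R -> R) (-1) by exact: is_deriveNid.
have := @is_derive1_comp R expR -%R r _ _ (is_derive_expR (- r)) H.
by rewrite mulrN1.
Qed.

Lemma is_derive_sinh r : is_derive r 1 sinh (cosh r).
Proof.
have H1 := is_derive_expR r; have H2 := is_derive_expRN r.
have -> : sinh = 2^-1 \*: ((expR : R -> R) - (fun s : R => expR (- s))).
  by apply/funext => s; rewrite /sinh /= mulrC.
by apply: is_derive_eq; rewrite /cosh opprK mulrC.
Qed.

Lemma is_derive_cosh r : is_derive r 1 cosh (sinh r).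
Proof.
have H1 := is_derive_expR r; have H2 := is_derive_expRN r.
have -> : cosh = 2^-1 \*: ((expR : R -> R) + (fun s : R => expR (- s))).
  by apply/funext => s; rewrite /cosh /= mulrC.
by apply: is_derive_eq; rewrite /sinh mulrC.
Qed.

Lemma dot_polar r th : dot (polar r th) (polar r th) = sinh r ^+ 2.
Proof. by rewrite /dot /polar/= -[RHS]mulr1 -(cos2Dsin2 th); ring. Qed.

Lemma gH_polar r th vr vth wr wth :
  gH (polar r th) (polar_vec r th vr vth) (polar_vec r th wr wth)
  = vr * wr + sinh r ^+ 2 * (vth * wth).
Proof.
have C2 := cosh2_sinh2 r; have cs := cos2Dsin2 th; have C0 := cosh_gt0 r.
have Ev a b : dot (polar r th) (polar_vec r th a b) = sinh r * cosh r * a.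
  transitivity (sinh r * cosh r * a * (cos th ^+ 2 + sin th ^+ 2)).
    rewrite /dot /polar /polar_vec /=.
    by rewrite /GRing.scale/=; ring.
  by rewrite cs mulr1.
have -> : gH (polar r th) (polar_vec r th vr vth) (polar_vec r th wr wth) =
  (cosh r ^+ 2 * (vr * wr) + sinh r ^+ 2 * (vth * wth))
  - sinh r ^+ 2 * (vr * wr).
  rewrite /gH !Ev dot_polar -C2; congr (_ - _).
    transitivity ((cosh r ^+ 2 * (vr * wr) + sinh r ^+ 2 * (vth * wth))
                   * (cos th ^+ 2 + sin th ^+ 2)).
      by rewrite /dot /polar_vec /= /GRing.scale/=; ring.
    by rewrite cs mulr1.
  by field; rewrite gt_eqF.
by rewrite C2; ring.
Qed.

Lemma vol_density_polar r th :
  vol_density (polar r th)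
    * ((polar_dr r th).1 * (polar_dth r th).2
       - (polar_dr r th).2 * (polar_dth r th).1) = sinh r.
Proof.
have C2 := cosh2_sinh2 r; have cs := cos2Dsin2 th; have C0 := cosh_gt0 r.
have -> : vol_density (polar r th) = (cosh r)^-1.
  rewrite /vol_density.
  have N x : 1 + dot x x != 0.
    by rewrite gt_eqF// ltr_pwDl// addr_ge0// -expr2 sqr_ge0.
  have -> : forall x, gH x (1, 0) (1, 0) * gH x (0, 1) (0, 1)
      - gH x (1, 0) (0, 1) ^+ 2 = (1 + dot x x)^-1.
    by move=> x; have := N x; rewrite /gH /dot/= => Nx; field.
  by rewrite dot_polar -C2 -exprVn sqrtr_sqr ger0_norm// invr_ge0 ltW.
rewrite /polar_dr /polar_dth/=.
transitivity (sinh r * (cos th ^+ 2 + sin th ^+ 2)).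
  by field; rewrite gt_eqF.
by rewrite cs mulr1.
Qed.

Lemma is_derive_pair (V W : normedModType R) (f : R -> V) (g : R -> W)
    (s : R) (a : V) (b : W) :
  is_derive s 1 f a -> is_derive s 1 g b ->
  is_derive s 1 (fun y => (f y, g y)) (a, b).
Proof.
move=> [df <-] [dg <-].
have Df : differentiable f s by apply/derivable1_diffP.
have Dg : differentiable g s by apply/derivable1_diffP.
apply: DeriveDef; first exact/diff_derivable/differentiable_pair.
by rewrite !deriveE ?diff_pair//; exact: differentiable_pair.
Qed.

Lemma is_derive_dot x u w : is_derive x u (fun y => dot y w) (dot u w).
Proof.
have E : \forall h \near 0^', h^-1 *: (dot (h *: u + x) w - dot x w) = dot u w.
  near=> h.
  have h0 : h != 0 by near: h; exact: nbhs_dnbhs_neq.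
  by rewrite /dot/= /GRing.scale/=; field.
apply: DeriveDef.
  by apply: (@is_cvg_near_cst _ _ (dot u w)); exact: E.
by apply: lim_near_cst; last exact: E.
Unshelve. all: by end_near. Qed.

Lemma dot_ge0 x : 0 <= dot x x.
Proof. by rewrite addr_ge0// -expr2 sqr_ge0. Qed.

Lemma derive_gH x u v w :
  'D_u (fun y => gH y v w) x
  = - (dot u v * dot x w + dot x v * dot u w) / (1 + dot x x)
    + 2 * dot x v * dot x w * dot x u / (1 + dot x x) ^+ 2.
Proof.
have N : 1 + dot x x != 0 by rewrite gt_eqF// ltr_pwDl// dot_ge0.
have D y : is_derive x u (fun q => dot q y) (dot u y) by exact: is_derive_dot.
have Dx : is_derive x u (fun q => 1 + dot q q) (2 * dot x u).
  have F1 : is_derive x u (fst : R * R -> R) u.1.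
    have -> : (fst : R * R -> R) = (fun y => dot y (1, 0)).
      by apply/funext => y; rewrite /dot/= mulr1 mulr0 addr0.
    by apply: is_derive_eq; rewrite /dot/= mulr1 mulr0 addr0.
  have F2 : is_derive x u (snd : R * R -> R) u.2.
    have -> : (snd : R * R -> R) = (fun y => dot y (0, 1)).
      by apply/funext => y; rewrite /dot/= mulr1 mulr0 add0r.
    by apply: is_derive_eq; rewrite /dot/= mulr1 mulr0 add0r.
  have -> : (fun q => 1 + dot q q) = cst 1
    + ((fst : R * R -> R) * (fst : R * R -> R)
       + (snd : R * R -> R) * (snd : R * R -> R)) by [].
  apply: is_derive_eq.
  by rewrite /dot/= /GRing.scale/=; ring.
have DV : is_derive x u (fun q => (1 + dot q q)^-1)
    (- (1 + dot x x) ^- 2 *: (2 * dot x u)).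
  apply: DeriveDef; first by apply: derivableV => //; case: Dx.
  by rewrite deriveV//; case: Dx => _ ->.
have -> : (fun y => gH y v w) = cst (dot v w)
  - (fun q => dot q v) * (fun q => dot q w) * (fun q => (1 + dot q q)^-1) by [].
have := D v; have := D w => Dw Dv.
rewrite derive_val.
by rewrite !fctE/= /GRing.scale/=; field.
Qed.

Lemma christoffel_koszul x u v w :
  2 * gH x (christoffel x u v) w =
  'D_u (fun y => gH y v w) x + 'D_v (fun y => gH y u w) x
  - 'D_w (fun y => gH y u v) x.
Proof.
have N : 1 + dot x x != 0 by rewrite gt_eqF// ltr_pwDl// dot_ge0.
rewrite !derive_gH /christoffel /gH.
have Z c : dot (c *: x) w = c * dot x w by rewrite /dot/= /GRing.scale/=; ring.
have Z' c : dot x (c *: x) = c * dot x x by rewrite /dot/= /GRing.scale/=; ring.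
rewrite Z Z'.
have S a b : dot a b = dot b a by rewrite /dot mulrC (mulrC a.2).
by rewrite (S v u) (S w u) (S w v); field.
Qed.

(* The geodesic field in polar coordinates, as the velocity of a curve:
   [vr d/dr + vth d/dth + vth^2 sinh r cosh r d/dvr - 2 vr vth coth r d/dvth]. *)
Lemma geodesic_field_polar r th vr vth : 0 < r ->
  is_derive (0 : R) 1
    (fun s => let r' := r + s * vr in let th' := th + s * vth in
      (polar r' th',
       polar_vec r' th' (vr + s * (vth ^+ 2 * (sinh r * cosh r)))
                        (vth - s * (2 * vr * vth * (cosh r / sinh r)))))
    (geodesic_field (polar r th, polar_vec r th vr vth)).
Proof.
move=> r0.
have S0 : sinh r != 0.
  by rewrite mulf_neq0// subr_eq0 gt_eqF// ltr_expR; lra.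
have L a b : is_derive (0 : R) 1 (fun s : R => a + s * b) b.
  have -> : (fun s : R => a + s * b) = cst a + b \*: (id : R -> R).
    by apply/funext => s; rewrite !fctE/= /GRing.scale/= mulrC.
  by apply: is_derive_eq; rewrite add0r /GRing.scale/= mulr1.
have E0 a b : a + 0 * b = a :> R by rewrite mul0r addr0.
have DS : is_derive (0 : R) 1 (fun s => sinh (r + s * vr)) (cosh r * vr).
  apply: (@is_derive1_comp _ sinh (fun s => r + s * vr)).
  by rewrite E0; exact: is_derive_sinh.
have DC : is_derive (0 : R) 1 (fun s => cosh (r + s * vr)) (sinh r * vr).
  apply: (@is_derive1_comp _ cosh (fun s => r + s * vr)).
  by rewrite E0; exact: is_derive_cosh.
have Ds : is_derive (0 : R) 1 (fun s : R => sin (th + s * vth)) (cos th * vth).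
  apply: (@is_derive1_comp _ sin (fun s => th + s * vth)).
  by rewrite E0; exact: is_derive_sin.
have Dc : is_derive (0 : R) 1 (fun s : R => cos (th + s * vth)) (- sin th * vth).
  apply: (@is_derive1_comp _ cos (fun s => th + s * vth)).
  by rewrite E0; exact: is_derive_cos.
set a := vth ^+ 2 * _; set b := 2 * vr * vth * _.
have DA := L vr a.
have DB : is_derive (0 : R) 1 (fun s : R => vth - s * b) (- b).
  by have := L vth (- b); under eq_fun do rewrite mulrN.
rewrite /geodesic_field/= /christoffel gH_polar scaleNr opprK.
have C2 := cosh2_sinh2 r.
apply: is_derive_pair.
  apply: is_derive_pair.
    apply: (is_derive_eq (is_deriveM DS Dc)).
    by rewrite !E0 /polar_vec/= /GRing.scale/=; ring.
  apply: (is_derive_eq (is_deriveM DS Ds)).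
  by rewrite !E0 /polar_vec/= /GRing.scale/=; ring.
apply: is_derive_pair.
  apply: (is_derive_eq (is_deriveD (is_deriveM DA (is_deriveM DC Dc))
    (is_deriveM DB (is_deriveN (is_deriveM DS Ds))))).
  rewrite !fctE/= !E0 mul0r subr0 /GRing.scale/= /a /b.
  transitivity (sinh r * cos th * (vth ^+ 2 * (cosh r ^+ 2 - 1) + vr ^+ 2)).
    by field.
  by rewrite C2; ring.
apply: (is_derive_eq (is_deriveD (is_deriveM DA (is_deriveM DC Ds))
  (is_deriveM DB (is_deriveM DS Dc)))).
rewrite !fctE/= !E0 mul0r subr0 /GRing.scale/= /a /b.
transitivity (sinh r * sin th * (vth ^+ 2 * (cosh r ^+ 2 - 1) + vr ^+ 2)).
  by field.
by rewrite C2; ring.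
Qed.

End HyperbolicPlane.

(* Main.v *)
Require Import Defs.
From mathcomp Require Import all_boot all_order all_algebra.
From mathcomp Require Import all_classical all_reals all_analysis.
From mathcomp Require Import measurable_realfun ring lra.
Import Order.TTheory GRing.Theory Num.Theory.
Import numFieldNormedType.Exports.
Local Open Scope classical_set_scope.
Local Open Scope ring_scope.

(** In Minkowski space a geodesic of speed s satisfies Y'' = s^2 Y, so in the
    chart the flow is y(t) = cosh(s t) y + (sinh(s t) / s) v, v(t) = y'(t): it
    is linear once s is fixed, and s is conserved ([flow], [flow_speed],
    [is_derive_flow]).  A solution is constant along these curves, hence
    f(t, z) = f0 (flow (- t) z) ([vlasov_characteristics]).  Write [height y]
    for the Minkowski coordinate y0 = sqrt(1 + |y|^2), which is cosh r in polar
    coordinates; the volume density of the fibre is 1 / y0.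

    Decay.  Let z = (y, v) with flow (- t) z in K; then z obeys three bounds
    ([support_bound]).  The conserved speed lies between alpha and some P, so
    y0 >= exp(alpha t) / (4 P), since y0 grows like cosh(s t), and |v| <= P y0.
    The angular momentum [cross y v] is conserved, hence bounded by P^2.  For
    fixed y the last two conditions confine v to a long thin parallelogram, of
    length O(y0) and width O(1 / y0), whose area is bounded uniformly in y and
    t ([Rintegral_fiber_le]).  The factor 1 / y0 of the volume density then
    yields exp(- alpha t) ([fiber_decay]).

    Derivatives.  The boost of Minkowski space in a unit direction e is an
    isometry, so the lift [boost e] of its Killing field y0 e to TH^2 commutes
    with the geodesic flow and preserves the volume of the fibres.  Hence the
    derivative of f(t, .) along it is the transported derivative of f0, which
    does not grow in time ([boost_invariance]), and the derivative of the density
    along y0 e is the fibre integral of that quantity ([Rintegral_boost],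
    [Rintegral_fiber_derive]), to which the decay estimate applies again.  Both
    vectors of the polar frame are values of such fields: d/dr at
    [polar r th] is the boost in the direction of the point, and
    (1 / sinh r) d/dth is 1 / cosh r times the boost in the orthogonal
    direction.  This last factor 1 / cosh r = 1 / y0 is the second
    exp(- alpha t) of the angular estimate; as no division by sinh r remains,
    the bound is uniform up to r = 0 ([rho_derive_th], [rho_derive_r]). *)

Set Implicit Arguments.
Unset Strict Implicit.
Unset Printing Implicit Defensive.

(** * Integration over the plane *)

Section IntegrationPlane.
Variable R : realType.
Local Notation mu := (@lebesgue_measure R).
Local Notation mu2 := (@lebesgue_measure R \x @lebesgue_measure R)%E.

(** An open set is a countable union of the squares with rational centre and
    radius that it contains, and such squares are products of intervals. *)
Lemma open_measurable_plane (U : set (R * R)) : open U -> measurable U.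
Proof.
move=> oU.
pose box (q : rat * rat * rat) : set (R * R) :=
  ball (ratr q.1.1 : R) (ratr q.2 : R) `*` ball (ratr q.1.2 : R) (ratr q.2 : R).
pose F a b c := if pselect (box (a, b, c) `<=` U) then box (a, b, c) else set0.
have -> : U = \bigcup_a \bigcup_b \bigcup_c F a b c.
  apply/seteqP; split => [[x y] Uxy|p [a _ [b _ [c _]]]]; last first.
    by rewrite /F; case: pselect => // S; exact: S.
  have : nbhs (x, y) U by exact: open_nbhs_nbhs.
  rewrite -nbhs_ballE => -[e /= e0 eU].
  have [c /andP[]] : exists c : rat, (0 < ratr c :> R) && (ratr c < e / 2 :> R).
    have [c] := @rat_in_itvoo R 0 (e / 2) (divr_gt0 e0 (ltr0n _ 2)).
    by rewrite in_itv/=; exists c.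
  move=> c0 ce.
  have H (z : R) : exists a : rat, ball (ratr a : R) (ratr c : R) z.
    have [a] := @rat_in_itvoo R (z - ratr c) (z + ratr c) ltac:(lra).
    rewrite in_itv/= => /andP[a1 a2]; exists a.
    by rewrite /ball/= ltr_norml; apply/andP; split; lra.
  have [a xa] := H x; have [b yb] := H y.
  exists a => //; exists b => //; exists c => //.
  rewrite /F; case: pselect => // nS; exfalso; apply: nS => -[x1 y1] [/= x1a y1b].
  apply: eU; split => /=.
    move: xa x1a; rewrite /ball/= !ltr_norml => /andP[? ?] /andP[? ?].
    by apply/andP; split; lra.
  move: yb y1b; rewrite /ball/= !ltr_norml => /andP[? ?] /andP[? ?].
  by apply/andP; split; lra.
apply: bigcupT_measurable_rat => a; apply: bigcupT_measurable_rat => b.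
apply: bigcupT_measurable_rat => c; rewrite /F; case: pselect => [?|?]; last exact: measurable0.
by apply: measurableX; apply: open_measurable; exact: ball_open.
Qed.

Lemma continuous_measurable_plane (g : R * R -> R) :
  continuous g -> measurable_fun setT g.
Proof.
move=> cg; apply: (measurability _ (RGenOpens.measurableE R)).
move=> _ [_ [a [b ->] <-]]; rewrite setTI.
by apply: open_measurable_plane; apply: open_comp => //; exact: interval_open.
Qed.

Lemma plane_norm_le (v : R * R) N : (`|v| <= N) = (`|v.1| <= N) && (`|v.2| <= N).
Proof. by case: v => a b; rewrite prod_normE/= ge_max. Qed.

Lemma square_itvE N :
  [set v : R * R | `|v| <= N] = `[- N, N]%classic `*` `[- N, N]%classic.
Proof.
apply/seteqP; split => v; rewrite /= !in_itv/= plane_norm_le -!ler_norml.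
  by move/andP.
by case=> -> ->.
Qed.

Lemma compact_square N : compact [set v : R * R | `|v| <= N].
Proof. by rewrite square_itvE; apply: compact_setX; exact: segment_compact. Qed.

Lemma measurable_square N : measurable [set v : R * R | `|v| <= N].
Proof. by rewrite square_itvE; apply: measurableX; exact: measurable_itv. Qed.

Lemma square_measure_lty N : (mu2 [set v : R * R | (`|v| <= N)%R] < +oo)%E.
Proof.
have L : (mu `[(- N)%R, N%R]%classic < +oo)%E.
  by rewrite lebesgue_measure_itv; case: ifP => _; rewrite -?EFinD ltry.
rewrite square_itvE [ltLHS]product_measure1E; [|exact: measurable_itv..].
by apply: lte_mul_pinfty => //; rewrite ge0_fin_numE.
Qed.

Lemma continuous_compact_bounded (T : topologicalType) (K : set T) (g : T -> R) :
  continuous g -> compact K ->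
  exists2 M : R, 0 <= M & forall p, K p -> `|g p| <= M.
Proof.
move=> cg cK.
have /compact_bounded [M [_ HM]] : compact (g @` K).
  by apply: continuous_compact => //; exact: continuous_subspaceT.
exists (`|M| + 1) => [|p Kp]; first by rewrite addr_ge0.
by apply: (HM (`|M| + 1)) => /=; [rewrite (le_lt_trans (ler_norm M))// ltrDl | exists p].
Qed.

Lemma integrable_compact_support (g : R * R -> R) N :
  continuous g -> (forall v, N < `|v| -> g v = 0) ->
  mu2.-integrable setT (EFin \o g).
Proof.
move=> cg g0.
have mg := continuous_measurable_plane cg.
pose B := [set v : R * R | `|v| <= N].
have mB : measurable B by exact: measurable_square.
have -> : EFin \o g = (EFin \o g) \_ B.
  apply/funext => v; rewrite patchE; case: ifPn => //.
  rewrite notin_setE /B/= => /negP; rewrite -ltNge => /g0 h.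
  by rewrite /= h.
apply/(@integrable_mkcond _ _ _ mu2 B (EFin \o g) mB).
apply: measurable_bounded_integrable => //.
- exact: square_measure_lty.
- exact: measurable_funTS.
- have [M M0 HM] := continuous_compact_bounded cg (@compact_square N).
  exists M; split; first by rewrite num_real.
  by move=> x Mx v Bv; apply: le_trans (ltW Mx); exact: HM.
Qed.

(** The values are extended reals so that the lemma can be iterated: it applies
    to a section of a function of two variables and then to the partial
    integral given by Fubini's theorem. *)
Lemma integral_interval_le (h : R -> \bar R) (c b M : R) : 0 <= b -> 0 <= M ->
  measurable_fun setT h -> (forall x, `|h x| <= M%:E)%E ->
  (forall x, b < `|x - c| -> h x = 0%E) ->
  (`|\int[mu]_x h x| <= (2 * b * M)%:E)%E.
Proof.
move=> b0 M0 mh hM h0.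
pose I := `[c - b, c + b]%classic : set R.
have mI : measurable I by exact: measurable_itv.
apply: le_trans; first exact: (le_abse_integral mu measurableT mh).
apply: (@le_trans _ _ (\int[mu]_x (M * \1_I x)%:E)%E).
  apply: ge0_le_integral => //.
  - exact: measurableT_comp.
  - apply/measurable_EFinP; apply: measurable_funM => //.
  - move=> x _; rewrite indicE; case: (boolP (x \in I)) => [_|].
      by rewrite mulr1.
    rewrite notin_setE /I/= in_itv/= => /negP H.
    by rewrite h0 ?abse0 ?mulr0// ltNge; apply: contra H; rewrite ler_distl.
under eq_integral do rewrite EFinM.
rewrite ge0_integralZl//=; last exact/measurable_EFinP.
have muI : (mu I <= (2 * b)%:E)%E.
  rewrite /I lebesgue_measure_itv/=; case: ifP => _; last by rewrite lee_fin mulr_ge0.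
  by rewrite -EFinD lee_fin; lra.
rewrite integral_indic// setIT mulrC EFinM.
by apply: lee_wpmul2l => //; rewrite lee_fin.
Qed.

(** The support lies in a parallelogram of area 4 a b with one pair of sides
    parallel to a coordinate axis.  In the application k is a quotient
    of two coordinates of a base point, and the orientation is chosen so that
    the denominator is not small.  Fubini's theorem in the matching order
    replaces a change of variables. *)
Lemma Rintegral_parallelogram_le (g : R * R -> R) (N a b k M : R) :
  continuous g -> (forall v, N < `|v| -> g v = 0) ->
  0 <= a -> 0 <= b -> 0 <= M -> (forall v, `|g v| <= M) ->
  (forall v, g v != 0 -> `|v.1| <= a /\ `|v.2 - k * v.1| <= b) \/
  (forall v, g v != 0 -> `|v.2| <= a /\ `|v.1 - k * v.2| <= b) ->
  `|\int[mu2]_v g v| <= 4 * a * b * M.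
Proof.
move=> cg gN a0 b0 M0 gM H.
have ig := integrable_compact_support cg gN.
have mg : measurable_fun setT (EFin \o g) by exact: measurable_int ig.
suff : (`|\int[mu2]_v (g v)%:E| <= (4 * a * b * M)%:E)%E.
  rewrite /Rintegral => L.
  have : (\int[mu2]_v (g v)%:E)%E \is a fin_num by apply: integrable_fin_num.
  by move=> /fineK E; rewrite -lee_fin; move: L; rewrite -{1}E.
case: H => H.
  rewrite -(integral12_prod_meas1 ig).
  have -> : 4 * a * b * M = 2 * a * (2 * b * M) by ring.
  have gz x y : (a < `|x|) \/ (b < `|y - k * x|) -> g (x, y) = 0.
    move=> W; apply/eqP; apply: contraT => /H/= [h1 h2].
    by case: W; rewrite ltNge ?h1 ?h2.
  apply: (@integral_interval_le _ 0) => //.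
  - by rewrite !mulr_ge0.
  - exact: (measurable_fubini_F ig).
  - move=> x; apply: (@integral_interval_le _ (k * x)) => //.
    + exact: (measurableT_comp mg (pair1_measurable x)).
    + by move=> y; rewrite lee_fin.
    + by move=> y; rewrite /= => L; rewrite gz//; right.
  - move=> x; rewrite subr0 => L; rewrite /fubini_F integral0_eq//= => y _.
    by rewrite gz//; left.
rewrite -(integral21_prod_meas1 ig).
have -> : 4 * a * b * M = 2 * a * (2 * b * M) by ring.
have gz x y : (a < `|y|) \/ (b < `|x - k * y|) -> g (x, y) = 0.
  move=> W; apply/eqP; apply: contraT => /H/= [h1 h2].
  by case: W; rewrite ltNge ?h1 ?h2.
apply: (@integral_interval_le _ 0) => //.
- by rewrite !mulr_ge0.
- exact: (measurable_fubini_G ig).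
- move=> x; apply: (@integral_interval_le _ (k * x)) => //.
  + exact: measurableT_comp.
  + by move=> y; rewrite lee_fin.
  + by move=> y; rewrite /= => L; rewrite gz//; right.
- move=> x; rewrite subr0 => L; rewrite /fubini_G integral0_eq//= => y _.
  by rewrite gz//; left.
Qed.

Lemma integral_derive_compact0 (h h' : R -> R) (N : R) :
  (forall x : R, is_derive x 1 h (h' x)) -> continuous h' ->
  (forall x, N < `|x| -> h x = 0) -> (\int[mu]_x (h' x)%:E = 0)%E.
Proof.
move=> dh ch' h0.
(* A segment that is nondegenerate and strictly larger than the support,
   so that h also vanishes at its end points. *)
pose A := Num.max N 0 + 1.
have A0 : 0 < A by rewrite ltr_wpDl// le_max lexx orbT.
have NA : N < A by rewrite (@le_lt_trans _ _ (Num.max N 0)) ?le_max ?lexx// ltrDl.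
have h'0 x : A < `|x| -> h' x = 0.
  move=> Ax; have [_ <-] := dh x.
  have W : \forall z \near x, 0 = h z.
    have : \forall z \near x, A < `|z|.
      by apply: (cvgr_gt _ (@norm_continuous _ _ x)).
    by apply: filterS => z Az; rewrite h0// (lt_trans NA).
  by rewrite -(near_eq_derive _ W) ?derive_cst// oner_neq0.
have ch : continuous h.
  by move=> x; apply/differentiable_continuous/derivable1_diffP; case: (dh x).
have AA : - A < A by rewrite (lt_trans _ A0)// oppr_lt0.
have := @continuous_FTC2 R h' h (- A) A AA.
move=> /(_ _ _ _)/wrap[].
- exact: continuous_subspaceT.
- split.
  + by move=> x _; case: (dh x).
  + by apply: cvg_at_right_filter; exact: ch.
  + by apply: cvg_at_left_filter; exact: ch.
- by move=> x _; rewrite derive1E; case: (dh x).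
have hA : h A = 0 by rewrite h0// gtr0_norm.
have hNA : h (- A) = 0 by rewrite h0// normrN gtr0_norm.
rewrite hA hNA subee// => <-.
rewrite [RHS]integral_mkcond; apply: eq_integral => x _.
rewrite patchE; case: ifPn => //; rewrite notin_setE/= in_itv/= => /negP.
by rewrite -ler_norml -ltNge => /h'0 ->.
Qed.

End IntegrationPlane.

(** * Differentiation and fibre integrals *)

Section Calculus.
Variable R : realType.
Local Notation mu2 := (@lebesgue_measure R \x @lebesgue_measure R)%E.

(** The chain rule for curves, which is how all directional derivatives below
    are compared. *)
Lemma is_derive_along (V W : normedModType R) (F : V -> W) (c : R -> V)
    (s : R) (a : V) :
  differentiable F (c s) -> is_derive s 1 c a ->
  is_derive s 1 (fun h => F (c h)) ('D_a F (c s)).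
Proof.
move=> dF [dc <-].
have Dc : differentiable c s by apply/derivable1_diffP.
have DFc : differentiable (F \o c) s by exact: differentiable_comp.
apply: DeriveDef; first exact/diff_derivable.
by rewrite deriveE// diff_comp//= deriveE// deriveE.
Qed.

Lemma derive_comb (V : normedModType R) (F : V -> R) p (a b : R) (u w : V) :
  differentiable F p ->
  'D_(a *: u + b *: w) F p = a * 'D_u F p + b * 'D_w F p.
Proof. by move=> dF; rewrite !deriveE// linearD !linearZ. Qed.

Lemma deriveZ_dir (V : normedModType R) (F : V -> R) p (a : R) (u : V) :
  differentiable F p -> 'D_(a *: u) F p = a * 'D_u F p.
Proof. by move=> dF; rewrite !deriveE// linearZ. Qed.

Lemma derive_near0 (V : normedModType R) (F : V -> R) p (a : V) :
  (\forall q \near p, F q = 0) -> 'D_a F p = 0.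
Proof.
move=> F0; have [->|a0] := eqVneq a 0; first exact: derive0.
rewrite -[RHS](derive_cst (0 : R) p a); apply: near_eq_derive => //.
Qed.

Lemma derive_beyond_radius0 (V : normedModType R) (F : V -> R) N (a v : V) :
  (forall v, N < `|v| -> F v = 0) -> N < `|v| -> 'D_a F v = 0.
Proof.
move=> F0 Nv; apply: derive_near0.
have : \forall z \near v, N < `|z|.
  by apply: (cvgr_gt _ (@norm_continuous _ _ v)).
by apply: filterS => z; exact: F0.
Qed.

Lemma C1_continuous (V : normedModType R) (F : V -> R) : C1 setT F -> continuous F.
Proof. by move=> CF p; apply: differentiable_continuous; case: (CF p I). Qed.

Lemma C1_derive_continuous (V : normedModType R) (F : V -> R) (a : V) :
  C1 setT F -> continuous (fun p => 'D_a F p).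
Proof. by move=> CF p; case: (CF p I) => _; apply. Qed.

Lemma continuous_pair (T U W : topologicalType) (f : T -> U) (g : T -> W) :
  continuous f -> continuous g -> continuous (fun x => (f x, g x)).
Proof. by move=> cf cg x; apply: cvg_pair; [exact: cf|exact: cg]. Qed.

Lemma continuous_compT (T U W : topologicalType) (f : T -> U) (g : U -> W) :
  continuous f -> continuous g -> continuous (fun x => g (f x)).
Proof. by move=> cf cg x; apply: continuous_comp; [exact: cf|exact: cg]. Qed.

Lemma plane_dirE (e : R * R) : e = e.1 *: (1, 0) + e.2 *: (0, 1).
Proof.
case: e => a b; apply/pair_equal_spec; rewrite /= /GRing.scale/=.
by rewrite !mulr0 !mulr1 addr0 add0r.
Qed.

(** By Fubini's theorem and linearity in e, it suffices to integrate a
    derivative of a compactly supported function over a coordinate line. *)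
Lemma Rintegral_derive_compact0 (H : R * R -> R) N (e : R * R) : C1 setT H ->
  (forall v, N < `|v| -> H v = 0) -> \int[mu2]_v 'D_e H v = 0.
Proof.
move=> CH H0.
have cD a := @C1_derive_continuous _ _ a CH.
have iD a : mu2.-integrable setT (EFin \o (fun v => 'D_a H v)).
  by apply: (@integrable_compact_support _ _ N) => // v; exact: derive_beyond_radius0.
have dH v : differentiable H v by case: (CH v I).
have D1 : \int[mu2]_v 'D_(1, 0) H v = 0.
  rewrite /Rintegral -(integral21_prod_meas1 (iD (1, 0))).
  rewrite integral0_eq//= => y _; rewrite /fubini_G/=.
  apply: (@integral_derive_compact0 _ (fun x => H (x, y)) _ N).
  - move=> x; apply: (is_derive_along (c := fun x => (x, y))) => //.
    exact: is_derive_pair.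
  - apply: (@continuous_compT _ _ _ (fun x => (x, y)) _ _ (cD _)).
    by apply: continuous_pair => z; [exact: cvg_id|exact: cvg_cst].
  - by move=> x Nx; apply: H0; rewrite (lt_le_trans Nx)// prod_normE/= le_max lexx.
have D2 : \int[mu2]_v 'D_(0, 1) H v = 0.
  rewrite /Rintegral -(integral12_prod_meas1 (iD (0, 1))).
  rewrite integral0_eq//= => y _; rewrite /fubini_F/=.
  apply: (@integral_derive_compact0 _ (fun x => H (y, x)) _ N).
  - move=> x; apply: (is_derive_along (c := fun x => (y, x))) => //.
    exact: is_derive_pair.
  - apply: (@continuous_compT _ _ _ (fun x => (y, x)) _ _ (cD _)).
    by apply: continuous_pair => z; [exact: cvg_cst|exact: cvg_id].
  - by move=> x Nx; apply: H0; rewrite (lt_le_trans Nx)// prod_normE/= le_max lexx orbT.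
have -> : (fun v => 'D_e H v) = (fun v => e.1 * 'D_(1, 0) H v + e.2 * 'D_(0, 1) H v).
  by apply/funext => v; rewrite {1}(plane_dirE e) derive_comb.
rewrite RintegralD//.
- by rewrite !RintegralZl// D1 D2 !mulr0 addr0.
- have := integrableZl measurableT e.1 (iD (1, 0)).
  by apply: eq_integrable => //= v _; rewrite EFinM.
- have := integrableZl measurableT e.2 (iD (0, 1)).
  by apply: eq_integrable => //= v _; rewrite EFinM.
Qed.

Lemma continuous_dot (x : R * R) : continuous (dot x).
Proof.
move=> v; rewrite /dot; apply: cvgD; apply: cvgM; first exact: cvg_cst.
- exact: cvg_fst.
- exact: cvg_cst.
- exact: cvg_snd.
Qed.

Lemma dotC (x y : R * R) : dot x y = dot y x.
Proof. by rewrite /dot mulrC (mulrC x.2). Qed.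

Lemma differentiable_dot (x v : R * R) : differentiable (dot x) v.
Proof.
have d1 : differentiable (fst : R * R -> R^o) v.
  by apply: linear_differentiable => p; exact: cvg_fst.
have d2 : differentiable (snd : R * R -> R^o) v.
  by apply: linear_differentiable => p; exact: cvg_snd.
by rewrite /dot; apply: differentiableD; apply: differentiableM.
Qed.

Lemma derive_dot (x v e : R * R) : 'D_e (dot x) v = dot x e.
Proof.
have -> : dot x = (fun y => dot y x) by apply/funext => y; exact: dotC.
by have := is_derive_dot v e x => -[_ ->]; rewrite dotC.
Qed.

(** The divergence of the field v |-> (dot x v) e is dot x e.  This is the only
    divergence needed: the fibre component of the lifted boosts has this form. *)
Lemma Rintegral_by_parts_dot (G : R * R -> R) N (x e : R * R) : C1 setT G ->
  (forall v, N < `|v| -> G v = 0) ->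
  \int[mu2]_v (dot x v * 'D_e G v) = - (dot x e * \int[mu2]_v G v).
Proof.
move=> CG G0.
have dG v : differentiable G v by case: (CG v I).
have cG := C1_continuous CG.
have cD a := @C1_derive_continuous _ _ a CG.
have cdot := @continuous_dot x.
have DH a v : 'D_a (fun v => dot x v * G v) v = dot x v * 'D_a G v + dot x a * G v.
  have D1 : is_derive v a (dot x) (dot x a).
    by apply: DeriveDef; [exact/diff_derivable/differentiable_dot|exact: derive_dot].
  have D2 : is_derive v a G ('D_a G v) by apply/derivableP/diff_derivable.
  have [_ E] := is_deriveM D1 D2.
  transitivity ('D_a (dot x * G) v); first by [].
  by rewrite E /GRing.scale/= (mulrC (G v)).
have := @Rintegral_derive_compact0 (fun v => dot x v * G v) N e _ _.
move=> /(_ _ _)/wrap[].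
- move=> v _; split => [|a].
    by apply: differentiableM => //; exact: differentiable_dot.
  have -> : (fun q => 'D_a (fun v => dot x v * G v) q) =
     (fun v => dot x v * 'D_a G v + dot x a * G v) by apply/funext => q; exact: DH.
  by apply: cvgD; apply: cvgM; [exact: cdot|exact: cD|exact: cvg_cst|exact: cG].
- by move=> v /G0 ->; rewrite mulr0.
have -> : (fun v => 'D_e (fun v => dot x v * G v) v) =
    (fun v => dot x v * 'D_e G v + dot x e * G v) by apply/funext => q; exact: DH.
have iG : mu2.-integrable setT (EFin \o G).
  exact: (@integrable_compact_support _ _ N).
rewrite RintegralD//; last 2 first.
- apply: (@integrable_compact_support _ (fun v => dot x v * 'D_e G v) N).
    by move=> v; apply: cvgM; [exact: cdot|exact: cD].
  by move=> v Nv; rewrite (derive_beyond_radius0 _ G0)// mulr0.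
- have := integrableZl measurableT (dot x e) iG.
  by apply: eq_integrable => //= v _; rewrite EFinM.
by rewrite RintegralZl// => /eqP; rewrite addr_eq0 => /eqP.
Qed.

(** Differentiation under the integral sign: on the compact set of parameters
    within distance 1 of s and of fibre points in the square of radius N, the
    derivative of the integrand is bounded, which gives a dominating function. *)
Lemma is_derive_Rintegral_along (F : (R * R) * (R * R) -> R) (c c' : R -> R * R)
    (s N : R) : C1 setT F ->
  (forall h : R, is_derive h 1 c (c' h)) -> continuous c' ->
  (forall h v, `|h - s| < 1 -> N < `|v| -> F (c h, v) = 0) ->
  is_derive s 1 (fun h => \int[mu2]_v F (c h, v))
    (\int[mu2]_v 'D_(c' s, 0) F (c s, v)).
Proof.
move=> CF dc cc' F0.
have dF z : differentiable F z by case: (CF z I).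
have cF := C1_continuous CF.
have cD a := @C1_derive_continuous _ _ a CF.
have cc : continuous c.
  by move=> h; apply/differentiable_continuous/derivable1_diffP; case: (dc h).
have dFc v (h : R) : is_derive h 1 (fun h => F (c h, v)) ('D_(c' h, 0) F (c h, v)).
  by apply: (is_derive_along (c := fun h => (c h, v))) => //; exact: is_derive_pair.
pose E1 : (R * R) * (R * R) := ((1, 0), 0).
pose E2 : (R * R) * (R * R) := ((0, 1), 0).
have DE h v : 'D_(c' h, 0) F (c h, v) =
    (c' h).1 * 'D_E1 F (c h, v) + (c' h).2 * 'D_E2 F (c h, v).
  transitivity ('D_((c' h).1 *: E1 + (c' h).2 *: E2) F (c h, v)).
    congr (derive F (c h, v) _).
    have -> : (c' h).1 *: E1 + (c' h).2 *: E2 =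
       ((c' h).1 *: (1, 0) + (c' h).2 *: (0, 1), (c' h).1 *: 0 + (c' h).2 *: 0) by [].
    by rewrite -plane_dirE !scaler0 addr0.
  exact: derive_comb.
pose K : set (R * (R * R)) := `[s - 1, s + 1] `*` [set v | `|v| <= N].
have cK : compact K by apply: compact_setX; [exact: segment_compact|exact: compact_square].
have cDD : continuous (fun p : R * (R * R) => 'D_(c' p.1, 0) F (c p.1, p.2)).
  have -> : (fun p : R * (R * R) => 'D_(c' p.1, 0) F (c p.1, p.2)) =
    (fun p : R * (R * R) => (c' p.1).1 * 'D_E1 F (c p.1, p.2)
                          + (c' p.1).2 * 'D_E2 F (c p.1, p.2)).
    by apply/funext => p; exact: DE.
  have c1 : continuous (fun p : R * (R * R) => c' p.1).
    by apply: continuous_compT cc' => p; exact: cvg_fst.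
  have c2 : continuous (fun p : R * (R * R) => (c p.1, p.2)).
    apply: continuous_pair => p; last exact: cvg_snd.
    by move: p; apply: continuous_compT cc => p; exact: cvg_fst.
  move=> p; apply: cvgD; apply: cvgM.
  - by apply: (continuous_compT c1) => q; exact: cvg_fst.
  - exact: (continuous_compT c2 (cD _)).
  - by apply: (continuous_compT c1) => q; exact: cvg_snd.
  - exact: (continuous_compT c2 (cD _)).
have [M M0 HM] := continuous_compact_bounded cDD cK.
pose B : set (R * R) := [set v | `|v| <= N].
have mB : measurable B by exact: measurable_square.
have sI : `]s - 1, s + 1[%classic s by rewrite /= in_itv/=; apply/andP; split; lra.
have hI h : `]s - 1, s + 1[%classic h -> `|h - s| < 1.
  by rewrite /= in_itv/= => /andP[? ?]; rewrite ltr_norml; apply/andP; split; lra.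
have cvgI := @cvg_differentiation_under_integral R _ _ mu2
  (fun h v => F (c h, v)) setT measurableT s (s - 1) (s + 1) sI.
have intF h : `]s - 1, s + 1[%classic h -> mu2.-integrable setT (EFin \o (fun v => F (c h, v))).
  move=> Ih; apply: (@integrable_compact_support _ _ N).
    apply: (@continuous_compT _ _ _ (fun v => (c h, v)) _ _ cF).
    by apply: continuous_pair => z; [exact: cvg_cst|exact: cvg_id].
  by move=> v Nv; apply: F0 => //; exact: hI.
have derF h v : `]s - 1, s + 1[%classic h -> setT v -> derivable (fun h => F (c h, v)) h 1.
  by move=> _ _; case: (dFc v h).
have G0 v : 0 <= M * \1_B v by rewrite mulr_ge0.
have intG : mu2.-integrable setT (EFin \o (fun v => M * \1_B v)).
  have : mu2.-integrable setT (EFin \o (\1_B : R * R -> R)).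
    apply/integrableP; split; first exact/measurable_EFinP.
    have E : (\int[mu2]_x `|(\1_B x : R)%:E| = mu2 B)%E.
      under eq_integral => v _ do rewrite /= ger0_norm//.
      by rewrite integral_indic// setIT.
    by rewrite [ltLHS]E; exact: square_measure_lty.
  move/(integrableZl measurableT M).
  by apply: eq_integrable => //= v _; rewrite EFinM.
have d1E h v : partial1of2 (fun h v => F (c h, v)) h v = 'D_(c' h, 0) F (c h, v).
  by rewrite partial1of2E; case: (dFc v h).
have Gub h v : `]s - 1, s + 1[%classic h -> setT v ->
    `|partial1of2 (fun h v => F (c h, v)) h v| <= M * \1_B v.
  move=> Ih _; rewrite d1E indicE; case: (boolP (v \in B)) => [|].
    rewrite inE => Bv; rewrite mulr1; apply: (HM (h, v)); split => //=.
    by move: Ih; rewrite /= !in_itv/= => /andP[/ltW -> /ltW ->].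
  rewrite notin_setE => /negP; rewrite -ltNge => Nv.
  rewrite -(d1E h v) partial1of2E derive_near0 ?normr0 ?mulr0//.
  have : \forall q \near h, q \in `]s - 1, s + 1[ by exact: near_in_itvoo.
  by apply: filterS => q /hI qs; exact: F0.
have {cvgI} := cvgI intF derF _ G0 intG Gub.
have -> : (fun v => partial1of2 (fun h v => F (c h, v)) s v) =
    (fun v => 'D_(c' s, 0) F (c s, v)) by apply/funext => v; exact: d1E.
move=> H; apply: DeriveDef.
  by apply/cvg_ex; exists (\int[mu2]_v 'D_(c' s, 0) F (c s, v)) => /=;
    under eq_fun do rewrite scaler1.
by rewrite /derive; under eq_fun do rewrite scaler1; exact/cvg_lim.
Qed.

End Calculus.

(** * The hyperboloid and its geodesic flow *)

Section Hyperboloid.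
Variable R : realType.
Implicit Types (x y u v w e : R * R) (z q : (R * R) * (R * R)) (a s t : R).

(** The coordinate y0 of the hyperboloid y0^2 = 1 + |y|^2. *)
Definition height y : R := Num.sqrt (1 + dot y y).
(** The y0-component of the Minkowski vector with chart components v, that is,
    the derivative of [height] in the direction v. *)
Definition height_rate z : R := dot z.1 z.2 / height z.1.
Definition speed z : R := Num.sqrt (gH z.1 z.2 z.2).
(** On a phase point (y, v) this is the angular momentum about the origin. *)
Definition cross u w : R := u.1 * w.2 - u.2 * w.1.

Lemma dotDr u v w : dot u (v + w) = dot u v + dot u w.
Proof. by rewrite /dot /=; ring. Qed.
Lemma dotZr a u v : dot u (a *: v) = a * dot u v.
Proof. by rewrite /dot /= /GRing.scale/=; ring. Qed.
Lemma dotDl u v w : dot (v + w) u = dot v u + dot w u.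
Proof. by rewrite /dot /=; ring. Qed.
Lemma dotZl a u v : dot (a *: v) u = a * dot v u.
Proof. by rewrite /dot /= /GRing.scale/=; ring. Qed.

Lemma dot_lagrange u v : dot u u * dot v v = dot u v ^+ 2 + cross u v ^+ 2.
Proof. by rewrite /dot /cross; ring. Qed.

Lemma dot_cauchy u v : dot u v ^+ 2 <= dot u u * dot v v.
Proof. by rewrite dot_lagrange lerDl sqr_ge0. Qed.

Lemma height_gt0 y : 0 < height y.
Proof. by rewrite sqrtr_gt0 ltr_pwDl// dot_ge0. Qed.

Lemma height_sqr y : height y ^+ 2 = 1 + dot y y.
Proof. by rewrite sqr_sqrtr// addr_ge0// dot_ge0. Qed.

Lemma height_ge1 y : 1 <= height y.
Proof.
have := height_sqr y; have := dot_ge0 y; have := height_gt0 y; nra.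
Qed.

Lemma height_rateE z : height z.1 * height_rate z = dot z.1 z.2.
Proof. by rewrite mulrC divfK// gt_eqF// height_gt0. Qed.

(** The metric is the restriction of the Minkowski form. *)
Lemma gHE y u w : gH y u w = dot u w - height_rate (y, u) * height_rate (y, w).
Proof.
rewrite /gH /height_rate/= -height_sqr; congr (_ - _).
by field; rewrite gt_eqF// height_gt0.
Qed.

Lemma gH_le_dot y u : gH y u u <= dot u u.
Proof. by rewrite gHE lerBlDr lerDl -expr2 sqr_ge0. Qed.

(** In Minkowski terms: a tangent vector at y has Euclidean chart length at most
    y0 times its hyperbolic length, with equality in the radial direction. *)
Lemma dot_le_gH y u : dot u u <= height y ^+ 2 * gH y u u.
Proof.
rewrite gHE mulrBr.
have -> : height y ^+ 2 * (height_rate (y, u) * height_rate (y, u)) = dot y u ^+ 2.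
  by rewrite -(height_rateE (y, u)); ring.
by rewrite height_sqr; have := dot_cauchy y u; nra.
Qed.

Lemma gH_ge0 y u : 0 <= gH y u u.
Proof.
have := dot_le_gH y u; have := dot_ge0 u; have := height_gt0 y => h0 d0.
move=> /(le_trans d0); rewrite pmulr_rge0// exprn_gt0//.
Qed.

(** The Gram determinant of two vectors is the square of their determinant
    times det g = 1 / y0^2. *)
Lemma gH_gram y u w :
  gH y u u * gH y w w - gH y u w ^+ 2 = cross u w ^+ 2 / height y ^+ 2.
Proof.
rewrite height_sqr /gH /cross /dot.
have N : 1 + (y.1 * y.1 + y.2 * y.2) != 0.
  by rewrite gt_eqF// ltr_pwDl// addr_ge0// -expr2 sqr_ge0.
by field.
Qed.

Lemma gH_cauchy y u w : gH y u w ^+ 2 <= gH y u u * gH y w w.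
Proof. by rewrite -subr_ge0 gH_gram mulr_ge0 ?invr_ge0 ?sqr_ge0. Qed.

Lemma speed_ge0 z : 0 <= speed z.
Proof. exact: sqrtr_ge0. Qed.

Lemma speed_sqr z : speed z ^+ 2 = gH z.1 z.2 z.2.
Proof. by rewrite sqr_sqrtr// gH_ge0. Qed.

(** The gradient of y0 on the hyperbolic plane has norm |y|. *)
Lemma height_rate_speed z : height_rate z ^+ 2 <= speed z ^+ 2 * dot z.1 z.1.
Proof.
have H := height_sqr z.1; have D := height_rateE z; have C := dot_cauchy z.1 z.2.
rewrite speed_sqr gHE -surjective_pairing.
move: C; rewrite -D exprMn H => C.
by nra.
Qed.

Lemma dot_eq0 v : dot v v <= 0 -> v = 0.
Proof.
case: v => a b; rewrite /dot/= -!expr2 => H.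
have := sqr_ge0 a; have := sqr_ge0 b => b2 a2.
have /eqP : a ^+ 2 = 0 by lra.
have /eqP : b ^+ 2 = 0 by lra.
by rewrite !sqrf_eq0 => /eqP -> /eqP ->.
Qed.

Lemma speed_eq0 z : speed z = 0 -> z.2 = 0.
Proof.
move=> s0; apply: dot_eq0; have := dot_le_gH z.1 z.2.
by rewrite -speed_sqr s0 expr0n mulr0.
Qed.

Lemma sinh0 : sinh (0 : R) = 0.
Proof. by rewrite /sinh oppr0 subrr mul0r. Qed.

Lemma cosh0 : cosh (0 : R) = 1.
Proof. by rewrite /cosh oppr0 expR0 divff. Qed.

Lemma sinhN t : sinh (- t) = - sinh t.
Proof. by rewrite /sinh opprK -mulNr opprB. Qed.

Lemma coshN t : cosh (- t) = cosh t.
Proof. by rewrite /cosh opprK addrC. Qed.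

Lemma sinh_gt0 t : 0 < t -> 0 < sinh t.
Proof. by move=> t0; rewrite /sinh divr_gt0// subr_gt0 ltr_expR; lra. Qed.

(** The flow restricted to phase points of speed s.  For s = 0 the quotient
    sinh 0 / 0 is 0 instead of t, which is harmless: it multiplies v = 0. *)
Definition flow_with s t z : (R * R) * (R * R) :=
  (cosh (s * t) *: z.1 + (sinh (s * t) / s) *: z.2,
   (s * sinh (s * t)) *: z.1 + cosh (s * t) *: z.2).

Definition flow t z := flow_with (speed z) t z.

(** Holds for s = 0 as well, because both sides vanish. *)
Lemma sinh_divK s t : s * (sinh (s * t) / s) = sinh (s * t).
Proof.
have [->|s0] := eqVneq s 0; first by rewrite !mul0r sinh0.
by rewrite mulrC divfK.
Qed.

Lemma height_uniq y a : 0 < a -> a ^+ 2 = 1 + dot y y -> height y = a.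
Proof. by move=> a0 E; rewrite /height -E sqrtr_sqr gtr0_norm. Qed.

(** Since |height_rate z| <= s |y| and |y| = sqrt(y0^2 - 1) <= y0 - 1 / (2 y0),
    the worst case, a geodesic heading straight for the origin, leaves
    at least cosh(s t) (y0 - |y|).  The right-hand side is the height at time t
    ([flow_height]). *)
Lemma flow_height_ge t z (s := speed z) :
  cosh (s * t) / (2 * height z.1) <=
  cosh (s * t) * height z.1 + sinh (s * t) / s * height_rate z.
Proof.
set S := sinh (s * t) / s.
have c0 := cosh_gt0 (s * t); have C2 := cosh2_sinh2 (s * t).
have SE : s * S = sinh (s * t) by exact: sinh_divK.
have := height_rate_speed z; rewrite -/s; have h2 := height_sqr z.1.
have h1 := height_ge1 z.1; have d0 := dot_ge0 z.1 => r2.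
rewrite -SE in C2.
move: (cosh _) (height _) (height_rate _) (dot _ _) c0 C2 h2 h1 d0 r2.
move=> c h r d c0 C2 h2 h1 d0 r2.
have h0 : 0 < h by lra.
have P : (S * r) ^+ 2 <= c ^+ 2 * d.
  apply: (@le_trans _ _ (S ^+ 2 * (s ^+ 2 * d))).
    by rewrite exprMn ler_wpM2l ?sqr_ge0.
  by rewrite C2; nra.
(* The number b bounds |S r|: its square exceeds c^2 (h^2 - 1) by
   (c / (2 h))^2. *)
pose b := c * (h - (2 * h)^-1).
have b0 : 0 <= b.
  apply: mulr_ge0; first exact: ltW.
  rewrite subr_ge0; apply: (@le_trans _ _ 1) => //.
  by rewrite invf_le1 ?mulr_gt0//; lra.
have b2 : (S * r) ^+ 2 <= b ^+ 2.
  apply: (le_trans P); rewrite /b exprMn ler_wpM2l ?sqr_ge0//.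
  have -> : (h - (2 * h)^-1) ^+ 2 = d + ((2 * h)^-1) ^+ 2.
    have -> : d = h ^+ 2 - 1 by rewrite h2; ring.
    by field; rewrite gt_eqF.
  by rewrite lerDl sqr_ge0.
have : - b <= S * r.
  have := ler_norm (- (S * r)); rewrite normrN => /le_trans H.
  by rewrite lerNl; apply: H; rewrite -[leRHS]ger0_norm// -ler_sqr ?qualifE/= ?real_normK ?num_real.
by rewrite /b mulrBr; lra.
Qed.

Lemma flow_height_gt0 t z (s := speed z) :
  0 < cosh (s * t) * height z.1 + sinh (s * t) / s * height_rate z.
Proof.
apply: lt_le_trans (flow_height_ge t z).
by rewrite divr_gt0 ?cosh_gt0 ?mulr_gt0 ?height_gt0.
Qed.

(** The Minkowski Gram matrix of (Y, V): <Y,Y> = -1, <Y,V> = 0, <V,V> = s^2.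
    The flow acts on the pair by a matrix preserving these relations, which is
    why the next lemmas reduce to ring identities. *)
Lemma gram_height z (s := speed z) :
  [/\ dot z.1 z.1 = height z.1 ^+ 2 - 1,
      dot z.1 z.2 = height z.1 * height_rate z
    & dot z.2 z.2 = s ^+ 2 + height_rate z ^+ 2].
Proof.
split; first by rewrite height_sqr; ring.
  by rewrite height_rateE.
by rewrite speed_sqr gHE -surjective_pairing; ring.
Qed.

Lemma flow_height t z (s := speed z) :
  height (flow t z).1 =
  cosh (s * t) * height z.1 + sinh (s * t) / s * height_rate z.
Proof.
apply: height_uniq; first exact: flow_height_gt0.
rewrite /flow /flow_with -/s /=.
have C2 := cosh2_sinh2 (s * t); have SE := sinh_divK s t.
rewrite !(dotDl, dotDr, dotZl, dotZr) (dotC z.2 z.1).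
have [-> -> ->] := gram_height z; rewrite -/s; clearbody s.
move: (cosh _) (sinh _) (height _) (height_rate _) C2 SE => c b h r C2 SE.
move: (b / s) SE => S SE; rewrite -{}SE in C2.
by ring: C2.
Qed.

Lemma flow_height_rate t z (s := speed z) :
  height_rate (flow t z) =
  s * sinh (s * t) * height z.1 + cosh (s * t) * height_rate z.
Proof.
apply: (mulfI (lt0r_neq0 (height_gt0 (flow t z).1))).
rewrite height_rateE flow_height -/s.
rewrite /flow /flow_with -/s /=.
have C2 := cosh2_sinh2 (s * t); have SE := sinh_divK s t.
rewrite !(dotDl, dotDr, dotZl, dotZr) (dotC z.2 z.1).
have [-> -> ->] := gram_height z; rewrite -/s; clearbody s.
move: (cosh _) (sinh _) (height _) (height_rate _) C2 SE => c b h r C2 SE.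
move: (b / s) SE => S SE; rewrite -{}SE in C2 *.
by ring: C2.
Qed.

Lemma flow_speed t z : speed (flow t z) = speed z.
Proof.
apply: (@pexpIrn _ 2) => //; rewrite ?nnegrE ?speed_ge0//.
rewrite [LHS]speed_sqr gHE -surjective_pairing flow_height_rate.
rewrite /flow /flow_with /=; set s := speed z.
have C2 := cosh2_sinh2 (s * t); have SE := sinh_divK s t.
rewrite !(dotDl, dotDr, dotZl, dotZr) (dotC z.2 z.1).
have [-> -> ->] := gram_height z; rewrite -/s; clearbody s.
move: (cosh _) (sinh _) (height _) (height_rate _) C2 SE => c b h r C2 SE.
move: (b / s) SE => S SE; rewrite -{}SE in C2 *.
by ring: C2.
Qed.

(** The matrix of the flow in the basis (y, v) has determinant
    cosh^2 - sinh^2 = 1. *)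
Lemma flow_cross t z : cross (flow t z).1 (flow t z).2 = cross z.1 z.2.
Proof.
rewrite /flow /flow_with /=; set s := speed z.
have C2 := cosh2_sinh2 (s * t); have SE := sinh_divK s t.
rewrite /cross /= /GRing.scale/=; clearbody s.
move: (cosh _) (sinh _) C2 SE => c b C2 SE.
move: (b / s) SE => S SE; rewrite -{}SE in C2 *.
by ring: C2.
Qed.

Lemma flowK t z : flow t (flow (- t) z) = z.
Proof.
rewrite {1}/flow flow_speed /flow /flow_with /=; set s := speed z.
rewrite mulrN sinhN coshN.
have C2 := cosh2_sinh2 (s * t); have SE := sinh_divK s t.
clearbody s; move: (cosh _) (sinh _) C2 SE => c b C2 SE.
rewrite !mulNr; move: (b / s) SE => S SE; rewrite -{}SE in C2 *.
case: z => [[y1 y2] [v1 v2]].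
by congr ((_, _), (_, _)); rewrite /= /GRing.scale/=; ring: C2.
Qed.

Lemma flow0 z : flow 0 z = z.
Proof.
rewrite /flow /flow_with mulr0 sinh0 cosh0 mul0r mulr0 !scale0r !scale1r.
by rewrite addr0 add0r -surjective_pairing.
Qed.

End Hyperboloid.

(** * The geodesic equation and the boosts *)

Section FlowDerivatives.
Variable R : realType.
Implicit Types (x y u v w e : R * R) (z q : (R * R) * (R * R)) (a s t : R).

Lemma is_derive_scalel (V : normedModType R) (b : R -> R) (b' t : R) (y : V) :
  is_derive t 1 b b' -> is_derive t 1 (fun h => b h *: y) (b' *: y).
Proof.
move=> [db <-]; have Db : differentiable b t by apply/derivable1_diffP.
have D : differentiable (fun h => b h *: y) t by exact: differentiableZl.
apply: DeriveDef; first exact: diff_derivable.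
by rewrite !deriveE// diffZl.
Qed.

Lemma is_derive_sinh_comp (b : R -> R) (b' t : R) :
  is_derive t 1 b b' -> is_derive t 1 (fun h => sinh (b h)) (cosh (b t) * b').
Proof.
by move=> db; apply: (@is_derive1_comp _ (@sinh R) b) => //; exact: is_derive_sinh.
Qed.

Lemma is_derive_cosh_comp (b : R -> R) (b' t : R) :
  is_derive t 1 b b' -> is_derive t 1 (fun h => cosh (b h)) (sinh (b t) * b').
Proof.
by move=> db; apply: (@is_derive1_comp _ (@cosh R) b) => //; exact: is_derive_cosh.
Qed.

Lemma is_derive_mull s t : is_derive t 1 (fun h => s * h) s.
Proof.
have -> : (fun h => s * h) = s \*: (id : R -> R) by [].
by apply: is_derive_eq; rewrite /GRing.scale/= mulr1.
Qed.

Lemma is_derive_flow z t :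
  is_derive t 1 (fun h => flow h z) (geodesic_field (flow t z)).
Proof.
rewrite /geodesic_field /christoffel scaleNr opprK -speed_sqr flow_speed.
rewrite /flow /flow_with /=; set s := speed z.
have ds : is_derive t 1 (fun h => sinh (s * h)) (cosh (s * t) * s).
  exact/is_derive_sinh_comp/is_derive_mull.
have dc : is_derive t 1 (fun h => cosh (s * h)) (sinh (s * t) * s).
  exact/is_derive_cosh_comp/is_derive_mull.
have dS : is_derive t 1 (fun h => sinh (s * h) / s) (s^-1 * (cosh (s * t) * s)).
  have -> : (fun h => sinh (s * h) / s) = s^-1 \*: (fun h => sinh (s * h)).
    by apply/funext => h; exact: mulrC.
  exact: is_deriveZ.
have dT : is_derive t 1 (fun h => s * sinh (s * h)) (s * (cosh (s * t) * s)).
  exact: (@is_deriveZ _ _ _ (fun h => sinh (s * h)) s).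
apply: is_derive_pair.
  apply: is_derive_eq.
    exact: (is_deriveD (is_derive_scalel z.1 dc) (is_derive_scalel z.2 dS)).
  congr (_ + _); first by rewrite mulrC.
  have [s0|s0] := eqVneq s 0; first by rewrite (speed_eq0 s0) !scaler0.
  by congr (_ *: _); rewrite mulrC mulfK.
apply: is_derive_eq.
  exact: (is_deriveD (is_derive_scalel z.1 dT) (is_derive_scalel z.2 dc)).
have SE := sinh_divK s t.
rewrite scalerDr !scalerA; congr (_ *: _ + _ *: _); first by ring.
by move: (sinh (s * t)) SE => b SE; rewrite expr2 -[RHS]mulrA SE mulrC.
Qed.

(** The lift to the tangent bundle of the Killing field y |-> y0 e, which
    generates the Lorentz boosts in the direction e: its fibre component is
    the derivative of y0 e in the direction v. *)
Definition boost e z : (R * R) * (R * R) :=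
  (height z.1 *: e, height_rate z *: e).

Lemma is_derive_quadratic a b c :
  is_derive (0 : R) 1 (fun h : R => a + h * b + h * h * c) b.
Proof.
have d1 : is_derive (0 : R) 1 (fun h : R => h * b) b.
  by have := is_derive_mull b 0; under eq_fun do rewrite mulrC.
have d2 : is_derive (0 : R) 1 (fun h : R => h * h * c) 0.
  have -> : (fun h => h * h * c) = (id : R -> R) * (fun h : R => h * c).
    by apply/funext => h; rewrite fctE/= mulrA.
  have d3 : is_derive (0 : R) 1 (fun h : R => h * c) c.
    by have := is_derive_mull c 0; under eq_fun do rewrite mulrC.
  by apply: is_derive_eq; rewrite /GRing.scale/= !mul0r addr0.
have d0 : is_derive (0 : R) 1 (cst a : R -> R) 0 by exact: is_derive_cst.
have H := is_deriveD (is_deriveD d0 d1) d2. apply: (is_derive_eq H).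
by rewrite add0r addr0.
Qed.

(** Boosts are isometries, so the speed is stationary; the curve used is the
    straight line of the chart, along which this holds to first order. *)
Lemma is_derive_speed_sqr_boost e z :
  is_derive (0 : R) 1
    (fun h => gH (z + h *: boost e z).1 (z + h *: boost e z).2 (z + h *: boost e z).2) 0.
Proof.
have D := height_rateE z; have H2 := height_sqr z.1; have H0 := height_gt0 z.1.
rewrite /boost; set Y := height z.1; set r := height_rate z.
rewrite -/Y -/r in D H2 H0.
(* The metric along the line is Q1 - Q2^2 / Q3 with quadratic Q1, Q2, Q3. *)
pose Q1 (h : R) := dot z.2 z.2 + h * (2 * r * dot z.2 e) + h * h * (r ^+ 2 * dot e e).
pose Q2 (h : R) := dot z.1 z.2 + h * (r * dot z.1 e + Y * dot z.2 e) + h * h * (Y * r * dot e e).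
pose Q3 (h : R) := 1 + dot z.1 z.1 + h * (2 * Y * dot z.1 e) + h * h * (Y ^+ 2 * dot e e).
have d1 := is_derive_quadratic (dot z.2 z.2) (2 * r * dot z.2 e) (r ^+ 2 * dot e e).
have d2 := is_derive_quadratic (dot z.1 z.2) (r * dot z.1 e + Y * dot z.2 e) (Y * r * dot e e).
have d3 := is_derive_quadratic (1 + dot z.1 z.1) (2 * Y * dot z.1 e) (Y ^+ 2 * dot e e).
have Q30 : Q3 0 = Y ^+ 2 by rewrite /Q3 !mul0r !addr0 H2.
have Q3n : Q3 0 != 0 by rewrite Q30 gt_eqF// exprn_gt0.
have d3V : is_derive (0 : R) 1 (fun h => (Q3 h)^-1) (- (Q3 0) ^- 2 *: (2 * Y * dot z.1 e)).
  apply: DeriveDef; first by apply: derivableV => //; case: d3.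
  by rewrite deriveV//; case: d3 => _ ->.
have -> : (fun h => gH (z + h *: (Y *: e, r *: e)).1 (z + h *: (Y *: e, r *: e)).2
    (z + h *: (Y *: e, r *: e)).2) =
    (fun h => Q1 h) - ((fun h => Q2 h) * (fun h => Q2 h)) * (fun h => (Q3 h)^-1).
  apply/funext => h; rewrite /gH !fctE /Q1 /Q2 /Q3 /=.
  rewrite !(dotDl, dotDr, dotZl, dotZr) (dotC e z.1) (dotC e z.2).
  congr (_ - _ / _); ring.
have H := is_deriveB d1 (is_deriveM (is_deriveM d2 d2) d3V).
apply: (is_derive_eq H).
rewrite !fctE Q30 /GRing.scale/= !mul0r !addr0 -D.
by field; rewrite gt_eqF.
Qed.

Lemma is_derive_speed_boost e z : 0 < gH z.1 z.2 z.2 ->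
  is_derive (0 : R) 1 (fun h => speed (z + h *: boost e z)) 0.
Proof.
move=> g0.
have E : z + 0 *: boost e z = z by rewrite scale0r addr0.
have dq := is_derive_speed_sqr_boost e z.
have := @is_derive1_comp R Num.sqrt
  (fun h => gH (z + h *: boost e z).1 (z + h *: boost e z).2 (z + h *: boost e z).2)
  0 _ _ _ dq.
rewrite E => /(_ _ (is_derive1_sqrt g0)).
by rewrite mulr0.
Qed.

Lemma is_derive_line (V : normedModType R) (p L : V) (t : R) :
  is_derive t 1 (fun h : R => p + h *: L) L.
Proof.
have d0 : is_derive t 1 (cst p : R -> V) 0 by exact: is_derive_cst.
have d1 := is_derive_scalel L (is_derive_id t (1 : R)).
have H := is_deriveD d0 d1; apply: (is_derive_eq H).
by rewrite add0r scale1r.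
Qed.

(** As the speed is stationary, only the dependence of [flow_with] on the phase
    point contributes, and it is linear; the coefficients of e so obtained are
    the height and the height rate of the image ([flow_height],
    [flow_height_rate]). *)
Lemma is_derive_flow_boost e z t : 0 < gH z.1 z.2 z.2 ->
  is_derive (0 : R) 1 (fun h => flow t (z + h *: boost e z)) (boost e (flow t z)).
Proof.
move=> g0; have s0 : speed z != 0 by rewrite gt_eqF// sqrtr_gt0.
have ds := is_derive_speed_boost e g0.
rewrite /boost flow_height flow_height_rate -/(boost e z) /flow /flow_with.
set s := fun h => speed (z + h *: boost e z) in ds *.
have sz : s 0 = speed z by rewrite /s scale0r addr0.
have dst : is_derive (0 : R) 1 (fun h => s h * t) 0.
  have := is_deriveM ds (is_derive_cst t (0 : R) (1 : R)).
  by rewrite scaler0 scaler0 addr0.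
have dc : is_derive (0 : R) 1 (fun h => cosh (s h * t)) 0.
  by have := is_derive_cosh_comp dst; rewrite mulr0.
have dh : is_derive (0 : R) 1 (fun h => sinh (s h * t)) 0.
  by have := is_derive_sinh_comp dst; rewrite mulr0.
have dV : is_derive (0 : R) 1 (fun h => (s h)^-1) 0.
  apply: DeriveDef; first by apply: derivableV; [rewrite sz|case: ds].
  by rewrite deriveV; [case: ds => _ ->; rewrite scaler0|rewrite sz|case: ds].
have dS : is_derive (0 : R) 1 (fun h => sinh (s h * t) / s h) 0.
  by have := is_deriveM dh dV; rewrite !scaler0 addr0.
have dT : is_derive (0 : R) 1 (fun h => s h * sinh (s h * t)) 0.
  by have := is_deriveM ds dh; rewrite !scaler0 addr0.
have sc (b : R -> R) (p L : R * R) : is_derive (0 : R) 1 b 0 ->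
    is_derive (0 : R) 1 (fun h => b h *: (p + h *: L)) (b 0 *: L).
  move=> db; have dhb : is_derive (0 : R) 1 (fun h : R => b h * h) (b 0).
    have := is_deriveM db (is_derive_id (0 : R) (1 : R)).
    by rewrite scaler0 addr0 /GRing.scale/= mulr1.
  have -> : (fun h => b h *: (p + h *: L)) = (fun h => b h *: p) + (fun h => (b h * h) *: L).
    by apply/funext => h; rewrite fctE scalerDr scalerA.
  have H := is_deriveD (is_derive_scalel p db) (is_derive_scalel L dhb).
  apply: (is_derive_eq H).
  by rewrite scale0r add0r.
rewrite -sz.
apply: is_derive_pair.
  have H := is_deriveD (sc _ z.1 (boost e z).1 dc) (sc _ z.2 (boost e z).2 dS).
  apply: (is_derive_eq H).
  by rewrite /= !scalerA -scalerDl.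
have H := is_deriveD (sc _ z.1 (boost e z).1 dT) (sc _ z.2 (boost e z).2 dc).
apply: (is_derive_eq H).
by rewrite /= !scalerA -scalerDl.
Qed.

(** The flow commutes with isometries, hence with the lifted boosts.  Zero
    velocity is excluded because the speed is not differentiable there. *)
Lemma boost_invariance (f0 f : (R * R) * (R * R) -> R) e z t :
  (forall p, f p = f0 (flow t p)) -> differentiable f z ->
  differentiable f0 (flow t z) -> 0 < gH z.1 z.2 z.2 ->
  'D_(boost e z) f z = 'D_(boost e (flow t z)) f0 (flow t z).
Proof.
move=> fE df df0 g0.
have E : z + 0 *: boost e z = z by rewrite scale0r addr0.
have := @is_derive_along _ _ _ f (fun h => z + h *: boost e z) 0 (boost e z).
rewrite E => /(_ df (is_derive_line _ _ _)) [_ <-].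
have := @is_derive_along _ _ _ f0 (fun h => flow t (z + h *: boost e z)) 0 (boost e (flow t z)).
rewrite E => /(_ df0 (is_derive_flow_boost _ _ g0)) [_ <-].
suff -> : (fun h => f (z + h *: boost e z)) =
  (fun h => f0 (flow t (z + h *: boost e z))) by [].
by apply/funext => h; exact: fE.
Qed.

Lemma continuous_dot2 : continuous (fun z => dot z.1 z.2).
Proof.
have c1 : continuous (fun z : (R * R) * (R * R) => z.1) by move=> z; exact: cvg_fst.
have c2 : continuous (fun z : (R * R) * (R * R) => z.2) by move=> z; exact: cvg_snd.
have f1 : continuous (fst : R * R -> R) by move=> z; exact: cvg_fst.
have f2 : continuous (snd : R * R -> R) by move=> z; exact: cvg_snd.
move=> z; rewrite /dot; apply: cvgD; apply: cvgM.
- exact: (continuous_compT c1 f1).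
- exact: (continuous_compT c2 f1).
- exact: (continuous_compT c1 f2).
- exact: (continuous_compT c2 f2).
Qed.

Lemma continuous_gH : continuous (fun z => gH z.1 z.2 z.2).
Proof.
have c1 : continuous (fun z : (R * R) * (R * R) => z.1) by move=> z; exact: cvg_fst.
have c2 : continuous (fun z : (R * R) * (R * R) => z.2) by move=> z; exact: cvg_snd.
have d11 : continuous (fun z : (R * R) * (R * R) => dot z.1 z.1).
  exact: (continuous_compT (continuous_pair c1 c1) continuous_dot2).
have d22 : continuous (fun z : (R * R) * (R * R) => dot z.2 z.2).
  exact: (continuous_compT (continuous_pair c2 c2) continuous_dot2).
move=> z; rewrite /gH; apply: cvgB; first exact: d22.
apply: cvgM; first by apply: cvgM; exact: continuous_dot2.
apply: cvgV; first by rewrite gt_eqF// ltr_pwDl// dot_ge0.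
by apply: cvgD; [exact: cvg_cst|exact: d11].
Qed.

End FlowDerivatives.

(** * Transport along characteristics *)

Section Solutions.
Variable R : realType.
Local Notation mu2 := (@lebesgue_measure R \x @lebesgue_measure R)%E.
Implicit Types (x y u v w e : R * R) (z q : (R * R) * (R * R)) (a s t : R).

Lemma derive_slice (V W : normedModType R) (F : V * W -> R) (p : V) (q a : W) :
  differentiable F (p, q) ->
  differentiable (fun k => F (p, k)) q /\
  'D_a (fun k => F (p, k)) q = 'D_(0, a) F (p, q).
Proof.
move=> dF.
split.
  have di : differentiable (fun k : W => (p, k)) q by exact: differentiable_pair.
  exact: (@differentiable_comp _ _ _ _ (fun k : W => (p, k)) F).
have E (h : R) : h *: (0, a) + (p, q) = (p, h *: a + q) :> V * W.
  by apply/pair_equal_spec; rewrite /= scaler0 add0r.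
by rewrite /derive /=; under [in RHS]eq_fun => h do rewrite /= E.
Qed.

(** Along tau |-> (tau, flow (tau - t) z) the transport equation says that f has
    derivative zero for tau > 0; the mean value theorem on [0, t] needs only
    continuity at tau = 0, where the curve meets the initial datum. *)
Lemma vlasov_characteristics (f0 : (R * R) * (R * R) -> R) f t z :
  vlasov_solution f0 f -> 0 <= t -> f t z = f0 (flow (- t) z).
Proof.
move=> [f0E _ cf C1f eqf].
rewrite le_eqVlt => /predU1P[<-|t0]; first by rewrite oppr0 flow0 f0E.
pose F (p : R * ((R * R) * (R * R))) := f p.1 p.2.
pose c (tau : R) := (tau, flow (tau - t) z).
have dc (tau : R) : is_derive tau 1 c (1, geodesic_field (flow (tau - t) z)).
  apply: is_derive_pair.
  have dm : is_derive tau 1 (fun h => h - t) 1.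
    have H := is_deriveB (is_derive_id tau (1 : R)) (is_derive_cst t tau (1 : R)).
    by apply: (is_derive_eq H); rewrite subr0.
  have [d1 e1] := is_derive_flow z (tau - t).
  have D : differentiable (fun h => flow h z) (tau - t) by exact/derivable1_diffP.
  have := @is_derive_along _ _ _ (fun h => flow h z) (fun h => h - t) tau 1 D dm.
  by rewrite e1.
have dg (tau : R) : 0 < tau -> is_derive tau 1 (fun h => F (c h)) 0.
  move=> tau0.
  have [dF _] := C1f (c tau) tau0.
  have := is_derive_along dF (dc tau).
  set X := geodesic_field _.
  have -> : (1, X) = (1, 0) + (0, X) :> R * ((R * R) * (R * R)).
    by apply/pair_equal_spec; rewrite /= addr0 add0r.
  rewrite deriveE// linearD/= -!deriveE//.
  have := eqf tau (flow (tau - t) z) tau0; rewrite -/X.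
  have E1 : 'D_1 (fun s : R => f s (flow (tau - t) z)) tau = 'D_(1, 0) F (c tau).
    have dcc : is_derive tau 1 (fun s : R => (s, flow (tau - t) z)) (1, 0).
      by apply: is_derive_pair.
    by have [_] := @is_derive_along _ _ _ F (fun s : R => (s, flow (tau - t) z)) tau _ dF dcc.
  have E2 : 'D_X (f tau) (flow (tau - t) z) = 'D_(0, X) F (c tau).
    have [_ H] := @derive_slice _ _ F tau (flow (tau - t) z) X dF.
    exact: H.
  by rewrite E1 E2 => ->.
have cg : {within `[0, t], continuous (fun h => F (c h))}.
  apply/subspace_continuousP => tau; rewrite /= in_itv/= => /andP[tau0 taut].
  move/subspace_continuousP : cf => /(_ (c tau) tau0) cf.
  have cc : {for tau, continuous c}.
    by apply/differentiable_continuous/derivable1_diffP; case: (dc tau).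
  move=> A /cf nA.
  have {}nA : \forall p \near c tau, 0 <= p.1 -> A (F p) by exact: nA.
  have H : \forall h \near tau, h \in `[0, t] -> A (F (c h)).
    have : \forall h \near tau, 0 <= (c h).1 -> A (F (c h)) by exact: (cc _ nA).
    by apply: filterS => h /= H; rewrite in_itv/= => /andP[/H].
  exact: H.
have dg' (tau : R) : tau \in `]0, t[ -> is_derive tau 1 (fun h => F (c h)) 0.
  by rewrite in_itv/= => /andP[/dg].
have [r _] := MVT t0 dg' cg.
rewrite mul0r => /eqP; rewrite subr_eq0 => /eqP.
by rewrite /F /c /= subrr flow0 sub0r f0E.
Qed.

End Solutions.

(** * Supports, areas and the Sasaki metric *)

Section Estimates.
Variable R : realType.
Local Notation mu2 := (@lebesgue_measure R \x @lebesgue_measure R)%E.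
Implicit Types (x y u v w e : R * R) (z q : (R * R) * (R * R)) (a s t : R).

Lemma vlasov_slice_C1 (f0 : (R * R) * (R * R) -> R) f t :
  C1 setT f0 -> vlasov_solution f0 f -> 0 <= t -> C1 setT (f t).
Proof.
move=> C0 [f0E _ _ C1f _].
rewrite le_eqVlt => /predU1P[<-|t0]; first by rewrite f0E.
move=> z _; have [dF cF] := C1f (t, z) t0.
pose F (p : R * ((R * R) * (R * R))) := f p.1 p.2.
have S (k b : (R * R) * (R * R)) := @derive_slice _ _ _ F t k b (C1f (t, k) t0).1.
split=> [|b]; first by have [D _] := S z 0.
have -> : (fun q => 'D_b (f t) q) =
    (fun q => 'D_((0 : R), b) F (t, q)).
  by apply/funext => q; have [_ D] := S q b; exact: D.
have c1 : continuous (fun k : (R * R) * (R * R) => (t, k)).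
  by apply: continuous_pair => k; [exact: cvg_cst|exact: cvg_id].
exact: (continuous_comp (c1 z) (cF (0, b))).
Qed.

Lemma norm_le_of_sqr (a b : R) : 0 <= b -> a ^+ 2 <= b ^+ 2 -> `|a| <= b.
Proof.
by move=> b0 H; rewrite -(ger0_norm b0) -ler_sqr ?qualifE/= ?real_normK ?num_real.
Qed.

Lemma dot_sqr_le_norm1 v b : 0 <= b -> dot v v <= b ^+ 2 -> `|v.1| <= b.
Proof.
move=> b0 H; apply: norm_le_of_sqr => //; apply: le_trans H.
by rewrite /dot -!expr2 lerDl sqr_ge0.
Qed.

Lemma dot_sqr_le_norm2 v b : 0 <= b -> dot v v <= b ^+ 2 -> `|v.2| <= b.
Proof.
move=> b0 H; apply: norm_le_of_sqr => //; apply: le_trans H.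
by rewrite /dot -!expr2 lerDr sqr_ge0.
Qed.

Lemma dot_le_norm v b : `|v| <= b -> dot v v <= 2 * b ^+ 2.
Proof.
rewrite plane_norm_le => /andP[h1 h2]; rewrite /dot -!expr2.
have b0 : 0 <= b by exact: le_trans h1.
have : v.1 ^+ 2 <= b ^+ 2 by rewrite -real_normK ?num_real// ler_sqr ?qualifE/=.
have : v.2 ^+ 2 <= b ^+ 2 by rewrite -real_normK ?num_real// ler_sqr ?qualifE/=.
by lra.
Qed.

(** One constant P >= 1 controls position and velocity on K; every constant of
    the proof is a monomial in P. *)
Lemma compact_phase_bound (K : set ((R * R) * (R * R))) : compact K ->
  exists2 P : R, 1 <= P &
    forall z, K z -> height z.1 <= P /\ dot z.2 z.2 <= P ^+ 2.
Proof.
move=> /compact_bounded[M [_ HM]].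
pose N := `|M| + 1.
have N0 : 0 <= N by rewrite addr_ge0.
have KN z : K z -> `|z| <= N.
  by move=> Kz; apply: (HM N) => //; rewrite (le_lt_trans (ler_norm M))// ltrDl.
exists (1 + 2 * N ^+ 2); first by rewrite lerDl mulr_ge0 ?sqr_ge0.
move=> z /KN; rewrite prod_normE/= ge_max => /andP[/dot_le_norm h1 /dot_le_norm h2].
have := sqr_ge0 N => N2; split; last by nra.
have := height_ge1 z.1; have := height_sqr z.1 => h h'.
by apply: (@le_trans _ _ (height z.1 ^+ 2)); [rewrite ler_eXnr|lra].
Qed.

Lemma cosh_ge a : expR a / 2 <= cosh a.
Proof. by rewrite /cosh ler_pM2r// lerDl expR_ge0. Qed.

(** The three constraints on a phase point that comes from K after time t: its
    velocity and its angular momentum are bounded in terms of K, by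
    conservation laws, and its height has grown at the rate alpha. *)
Lemma support_bound (K : set ((R * R) * (R * R))) (alpha P t : R) z :
  0 < alpha -> K `<=` region alpha -> 1 <= P -> 0 <= t ->
  (forall q, K q -> height q.1 <= P /\ dot q.2 q.2 <= P ^+ 2) ->
  K (flow (- t) z) ->
  [/\ dot z.2 z.2 <= (P * height z.1) ^+ 2,
      `|cross z.1 z.2| <= P ^+ 2 & expR (alpha * t) <= 4 * P * height z.1].
Proof.
move=> alpha0 KR P1 t0 KP Kq; set q := flow (- t) z in Kq.
have P0 : 0 < P by lra.
(* All bounds hold at q, which lies in K; z is its image at time t. *)
have zE : z = flow t q by rewrite flowK.
have [hq wq] := KP _ Kq.
have sq : speed q ^+ 2 <= P ^+ 2 by rewrite speed_sqr (le_trans (gH_le_dot _ _)).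
have sa : alpha <= speed q.
  have : alpha ^+ 2 <= speed q ^+ 2 by rewrite speed_sqr; exact: KR.
  by rewrite ler_sqr ?qualifE/= ?speed_ge0// ltW.
split.
- apply: (le_trans (dot_le_gH z.1 z.2)); rewrite -speed_sqr zE flow_speed.
  by rewrite exprMn mulrC ler_wpM2r ?sqr_ge0.
- rewrite zE flow_cross; apply: norm_le_of_sqr; first exact: sqr_ge0.
  have := dot_lagrange q.1 q.2; have := sqr_ge0 (dot q.1 q.2) => c0 cE.
  apply: (@le_trans _ _ (dot q.1 q.1 * dot q.2 q.2)); first by rewrite cE lerDr.
  rewrite expr2 ler_pM ?dot_ge0//.
  have := height_sqr q.1; have := height_ge1 q.1; have := height_gt0 q.1.
  have : height q.1 ^+ 2 <= P ^+ 2 by have := height_gt0 q.1; nra.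
  lra.
- rewrite {1}zE flow_height.
  have L := flow_height_ge t q; have ch := cosh_ge (speed q * t).
  have E : expR (alpha * t) <= expR (speed q * t) by rewrite ler_expR ler_wpM2r.
  move: L; set Y := _ + _ => L.
  have h0 := height_gt0 q.1.
  have {}L : cosh (speed q * t) <= Y * (2 * height q.1).
    by rewrite -ler_pdivrMr ?mulr_gt0.
  have Y0 : 0 <= Y by rewrite ltW// flow_height_gt0.
  have : Y * (2 * height q.1) <= Y * (2 * P) by rewrite ler_wpM2l// ler_pM2l.
  lra.
Qed.

Lemma fiber_support_norm x P v : 0 <= P ->
  dot v v <= (P * height x) ^+ 2 -> `|v| <= P * height x.
Proof.
move=> P0 H; have h0 : 0 <= P * height x by rewrite mulr_ge0// ltW// height_gt0.
by rewrite plane_norm_le dot_sqr_le_norm1// dot_sqr_le_norm2.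
Qed.

(** When y0^2 > 2 some coordinate of x is at least y0 / 2 in absolute value, and
    dividing the bound on [cross x v] by it gives a parallelogram of length
    O(P y0) and width O(P^2 / y0).  When y0^2 <= 2 the bound on |v| alone
    suffices. *)
Lemma Rintegral_fiber_le (g : R * R -> R) x P M : 1 <= P -> 0 <= M ->
  continuous g -> (forall v, `|g v| <= M) ->
  (forall v, g v != 0 ->
    dot v v <= (P * height x) ^+ 2 /\ `|cross x v| <= P ^+ 2) ->
  `|\int[mu2]_v g v| <= 16 * P ^+ 3 * M.
Proof.
move=> P1 M0 cg gM gS.
have h1 := height_ge1 x; have hx := height_gt0 x; have h2 := height_sqr x.
have P0 : 0 < P by lra.
set h := height x in gS h1 hx h2 *.
have g0 v : P * h < `|v| -> g v = 0.
  move=> Nv; apply/eqP; apply: contraT => /gS[/(fiber_support_norm (ltW P0)) H _].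
  by rewrite leNgt Nv in H.
have Ph0 : 0 <= P * h by rewrite mulr_ge0// ltW.
have S1 v : g v != 0 -> `|v.1| <= P * h by move=> /gS[/(dot_sqr_le_norm1 Ph0)].
have S2 v : g v != 0 -> `|v.2| <= P * h by move=> /gS[/(dot_sqr_le_norm2 Ph0)].
have big (b : R) : h / 2 <= `|b| ->
    4 * (P * h) * (P ^+ 2 / `|b|) * M <= 16 * P ^+ 3 * M.
  move=> hb; rewrite ler_wpM2r//.
  have b0 : 0 < `|b| by lra.
  rewrite [X in X <= _]mulrA ler_pdivrMr//.
  have : 0 < P ^+ 3 by rewrite exprn_gt0.
  have -> : 4 * (P * h) * P ^+ 2 = 4 * (P ^+ 3 * h) by ring.
  nra.
have Pb0 (b : R) : 0 <= P ^+ 2 / `|b| by rewrite divr_ge0// sqr_ge0.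
have [L1|L1] := lerP (h / 2) `|x.1|.
  apply: (le_trans _ (big _ L1)).
  apply: (@Rintegral_parallelogram_le _ g (P * h) _ _ (x.2 / x.1)) => //; left => v gv.
  split; first exact: S1.
  have x0 : x.1 != 0 by rewrite -normr_gt0; lra.
  rewrite ler_pdivlMr ?normr_gt0// -normrM.
  have -> : (v.2 - x.2 / x.1 * v.1) * x.1 = cross x v by rewrite /cross; field.
  by have [] := gS _ gv.
have [L2|L2] := lerP (h / 2) `|x.2|.
  apply: (le_trans _ (big _ L2)).
  apply: (@Rintegral_parallelogram_le _ g (P * h) _ _ (x.1 / x.2)) => //; right => v gv.
  split; first exact: S2.
  have x0 : x.2 != 0 by rewrite -normr_gt0; lra.
  rewrite ler_pdivlMr ?normr_gt0// -normrM.
  have -> : (v.1 - x.1 / x.2 * v.2) * x.2 = - cross x v by rewrite /cross; field.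
  by rewrite normrN; have [] := gS _ gv.
have hle : h ^+ 2 <= 2.
  have : x.1 ^+ 2 <= (h / 2) ^+ 2.
    by rewrite -real_normK ?num_real// ler_sqr ?qualifE/= ?divr_ge0// ltW.
  have : x.2 ^+ 2 <= (h / 2) ^+ 2.
    by rewrite -real_normK ?num_real// ler_sqr ?qualifE/= ?divr_ge0// ltW.
  move: h2; rewrite /dot -!expr2 exprMn; lra.
apply: (@le_trans _ _ (4 * (P * h) * (P * h) * M)).
  apply: (@Rintegral_parallelogram_le _ g (P * h) _ _ 0) => //; left => v gv.
  by rewrite mul0r subr0; split; [exact: S1|exact: S2].
rewrite ler_wpM2r//.
have -> : 4 * (P * h) * (P * h) = 4 * (P ^+ 2 * h ^+ 2) by ring.
have -> : 16 * P ^+ 3 = 4 * (P ^+ 2 * (4 * P)) by ring.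
rewrite ler_pM2l// ler_pM2l ?exprn_gt0//; lra.
Qed.

Lemma sasakiZ z (xi : (R * R) * (R * R)) (c : R) :
  sasaki z (c *: xi) (c *: xi) = c ^+ 2 * sasaki z xi xi.
Proof.
rewrite /sasaki /christoffel /gH /= !(dotDl, dotDr, dotZl, dotZr).
ring.
Qed.

(** From the parallelogram law. *)
Lemma dot_add_le u w : dot (u + w) (u + w) <= 2 * dot u u + 2 * dot w w.
Proof.
have := dot_ge0 (u + (-1) *: w).
by rewrite !(dotDl, dotDr, dotZl, dotZr) (dotC w u); lra.
Qed.

(** The Cauchy-Schwarz inequality for gH bounds the scalar factor gH y v w. *)
Lemma christoffel_dot_le y v w P : 1 <= P -> height y <= P -> dot v v <= P ^+ 2 ->
  dot (christoffel y v w) (christoffel y v w) <= P ^+ 4 * gH y w w.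
Proof.
move=> P1 hP vP; rewrite /christoffel dotZl dotZr mulrA -expr2 sqrrN.
have := gH_cauchy y v w; have := gH_ge0 y w; have := gH_le_dot y v.
have := gH_ge0 y v; have := height_sqr y; have := height_ge1 y; have := dot_ge0 y.
move=> y0 h1 h2 gv gvd gw gc.
have yP : dot y y <= P ^+ 2 by nra.
have gvP : gH y v v <= P ^+ 2 by lra.
have -> : P ^+ 4 * gH y w w = (P ^+ 2 * gH y w w) * P ^+ 2 by ring.
apply: ler_pM => //; first exact: sqr_ge0.
by apply: (le_trans gc); rewrite ler_wpM2r.
Qed.

Lemma sasaki_boost_le e z P : 1 <= P -> dot e e = 1 ->
  height z.1 <= P -> dot z.2 z.2 <= P ^+ 2 ->
  sasaki z (boost e z) (boost e z) <= (4 * P ^+ 3) ^+ 2.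
Proof.
move=> P1 e1 hP vP; rewrite /sasaki /boost /=.
set Y := height z.1 in hP *; set r := height_rate z.
have P0 : 0 < P by lra.
have h0 : 0 < Y := height_gt0 z.1.
have gY : gH z.1 (Y *: e) (Y *: e) <= P ^+ 2.
  apply: (le_trans (gH_le_dot _ _)); rewrite dotZl dotZr e1 mulr1.
  by rewrite expr2 ler_pM// ltW.
have rP : r ^+ 2 <= P ^+ 4.
  apply: (le_trans (height_rate_speed z)); rewrite speed_sqr.
  have -> : P ^+ 4 = P ^+ 2 * P ^+ 2 by ring.
  apply: ler_pM; rewrite ?gH_ge0 ?dot_ge0//.
    exact: (le_trans (gH_le_dot _ _)).
  by have := height_sqr z.1; have := height_ge1 z.1; rewrite -/Y; nra.
have := christoffel_dot_le (Y *: e) P1 hP vP; set G := christoffel _ _ _ => GP.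
have gle : gH z.1 (r *: e + G) (r *: e + G) <= 2 * P ^+ 4 + 2 * P ^+ 6.
  apply: (le_trans (gH_le_dot _ _)); apply: (le_trans (dot_add_le _ _)).
  apply: lerD; rewrite ler_pM2l//.
    by rewrite dotZl dotZr e1 mulr1 -expr2.
  apply: (le_trans GP); have -> : P ^+ 6 = P ^+ 4 * P ^+ 2 by ring.
  by rewrite ler_pM2l// exprn_gt0.
have P26 : P ^+ 2 <= P ^+ 6 by rewrite ler_weXn2l.
have P46 : P ^+ 4 <= P ^+ 6 by rewrite ler_weXn2l.
have P6 : 0 < P ^+ 6 by rewrite exprn_gt0.
have -> : (4 * P ^+ 3) ^+ 2 = 16 * P ^+ 6 by ring.
lra.
Qed.

(** The Sasaki metric is uniformly definite over a compact set, so that its unit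
    ball is bounded in the chart.  This makes the suprema defining the
    W^(1,infinity) norm finite. *)
Lemma sasaki_unit_ball_bounded z P (xi : (R * R) * (R * R)) : 1 <= P ->
  height z.1 <= P -> dot z.2 z.2 <= P ^+ 2 -> sasaki z xi xi <= 1 ->
  [/\ `|xi.1.1| <= 2 * P ^+ 2, `|xi.1.2| <= 2 * P ^+ 2,
      `|xi.2.1| <= 2 * P ^+ 2 & `|xi.2.2| <= 2 * P ^+ 2].
Proof.
move=> P1 hP vP; rewrite /sasaki.
have P0 : 0 < P by lra.
have := christoffel_dot_le xi.1 P1 hP vP; set G := christoffel _ _ _ => GP.
have g1 := gH_ge0 z.1 xi.1; have g2 := gH_ge0 z.1 (xi.2 + G) => S1.
have Y2 : height z.1 ^+ 2 <= P ^+ 2 by have := height_ge1 z.1; nra.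
have P24 : P ^+ 2 <= P ^+ 4 by rewrite ler_weXn2l.
have P4 : 0 < P ^+ 4 by rewrite exprn_gt0.
have Q0 : 0 <= 2 * P ^+ 2 by rewrite mulr_ge0 ?sqr_ge0.
have E : (2 * P ^+ 2) ^+ 2 = 4 * P ^+ 4 by ring.
have dot_le u : gH z.1 u u <= 1 -> dot u u <= P ^+ 2.
  move=> u1; apply: (le_trans (dot_le_gH z.1 u)); apply: le_trans Y2.
  by rewrite ler_piMr ?sqr_ge0.
have x1 : dot xi.1 xi.1 <= (2 * P ^+ 2) ^+ 2.
  by apply: (le_trans (dot_le _ _)); [lra|rewrite E; lra].
have x2 : dot xi.2 xi.2 <= (2 * P ^+ 2) ^+ 2.
  have -> : xi.2 = (xi.2 + G) + (-1) *: G by rewrite scaleN1r addrK.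
  apply: (le_trans (dot_add_le _ _)).
  have := dot_le (xi.2 + G) ltac:(lra).
  rewrite dotZl dotZr E.
  have : P ^+ 4 * gH z.1 xi.1 xi.1 <= P ^+ 4 by apply: ler_piMr; [exact: ltW|lra].
  move=> /(le_trans GP); lra.
split; [exact: dot_sqr_le_norm1|exact: dot_sqr_le_norm2|
  exact: dot_sqr_le_norm1|exact: dot_sqr_le_norm2].
Qed.

Lemma supp_near0 (f : (R * R) * (R * R) -> R) z : ~ supp f z ->
  \forall q \near z, f q = 0.
Proof.
move=> nK; have oU : open (~` supp f) by apply: closed_openC; exact: closed_closure.
have : nbhs z (~` supp f) by exact: open_nbhs_nbhs.
apply: filterS => q nq; apply/eqP; apply: contrapT => /negP fq.
by apply: nq; exact: subset_closure.
Qed.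

Lemma derive_supp (f : (R * R) * (R * R) -> R) z xi : ~ supp f z -> 'D_xi f z = 0.
Proof. by move=> /supp_near0; exact: derive_near0. Qed.

Lemma derive_phase_coordE (xi : (R * R) * (R * R)) (f : (R * R) * (R * R) -> R) z :
  differentiable f z ->
  'D_xi f z = xi.1.1 * 'D_((1, 0), 0) f z + xi.1.2 * 'D_((0, 1), 0) f z
            + (xi.2.1 * 'D_(0, (1, 0)) f z + xi.2.2 * 'D_(0, (0, 1)) f z).
Proof.
move=> df.
pose a : (R * R) * (R * R) := xi.1.1 *: ((1, 0), 0) + xi.1.2 *: ((0, 1), 0).
pose b : (R * R) * (R * R) := xi.2.1 *: (0, (1, 0)) + xi.2.2 *: (0, (0, 1)).
have E : xi = 1 *: a + 1 *: b.
  rewrite !scale1r /a /b; case: xi @a @b => [[x1 x2] [x3 x4]] a b.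
  by congr ((_, _), (_, _)); rewrite /= /GRing.scale/=; ring.
transitivity ('D_(1 *: a + 1 *: b) f z); first by rewrite -E.
have Ha : 'D_a f z = xi.1.1 * 'D_((1, 0), 0) f z + xi.1.2 * 'D_((0, 1), 0) f z.
  exact: derive_comb.
have Hb : 'D_b f z = xi.2.1 * 'D_(0, (1, 0)) f z + xi.2.2 * 'D_(0, (0, 1)) f z.
  exact: derive_comb.
have Hab : 'D_(1 *: a + 1 *: b) f z = 1 * 'D_a f z + 1 * 'D_b f z.
  exact: derive_comb.
exact: (etrans Hab (f_equal2 +%R (etrans (mul1r _) Ha) (etrans (mul1r _) Hb))).
Qed.

(** Off the support the derivative vanishes; on it, all partial derivatives and
    all chart components of a Sasaki unit vector are bounded. *)
Lemma sasaki_derive_bounded (K : set ((R * R) * (R * R))) P f :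
  C1 setT f -> compact K -> supp f = K -> 1 <= P ->
  (forall q, K q -> height q.1 <= P /\ dot q.2 q.2 <= P ^+ 2) ->
  exists B, forall z xi, sasaki z xi xi <= 1 -> `|'D_xi f z| <= B.
Proof.
move=> Cf cK fK P1 KP.
have bd (d : (R * R) * (R * R)) := continuous_compact_bounded (@C1_derive_continuous _ _ f d Cf) cK.
have [B1 B10 H1] := bd ((1, 0), 0); have [B2 B20 H2] := bd ((0, 1), 0).
have [B3 B30 H3] := bd (0, (1, 0)); have [B4 B40 H4] := bd (0, (0, 1)).
have Q0 : 0 <= 2 * P ^+ 2 by rewrite mulr_ge0 ?sqr_ge0.
exists (2 * P ^+ 2 * B1 + 2 * P ^+ 2 * B2 + (2 * P ^+ 2 * B3 + 2 * P ^+ 2 * B4)).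
move=> z xi sx; have [Kz|nK] := pselect (K z); last first.
  by rewrite derive_supp ?fK// normr0 !addr_ge0// mulr_ge0.
have [hP vP] := KP _ Kz; have [x1 x2 x3 x4] := sasaki_unit_ball_bounded P1 hP vP sx.
have df : differentiable f z by case: (Cf z I).
rewrite derive_phase_coordE//.
apply: (le_trans (ler_normD _ _)); apply: lerD;
  apply: (le_trans (ler_normD _ _)); apply: lerD; rewrite normrM;
  apply: ler_pM => //; [exact: H1|exact: H2|exact: H3|exact: H4].
Qed.

Lemma le_norm_Linfty (K : set ((R * R) * (R * R))) f z :
  C1 setT f -> compact K -> supp f = K -> `|f z| <= norm_Linfty f.
Proof.
move=> Cf cK fK.
have [B B0 HB] := continuous_compact_bounded (C1_continuous Cf) cK.
apply: ub_le_sup; last by exists z.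
exists B => _ [q _ <-]; have [Kq|nK] := pselect (K q); first exact: HB.
have : ~ supp f q by rewrite fK.
by move/supp_near0/nbhs_singleton => ->; rewrite normr0.
Qed.

(** Rescale xi to the Sasaki unit ball.  Both suprema are over bounded sets by
    [sasaki_derive_bounded], hence bound the values they are taken over. *)
Lemma derive_le_W1infty (K : set ((R * R) * (R * R))) P f z xi Q :
  C1 setT f -> compact K -> supp f = K -> 1 <= P ->
  (forall q, K q -> height q.1 <= P /\ dot q.2 q.2 <= P ^+ 2) ->
  0 < Q -> sasaki z xi xi <= Q ^+ 2 -> `|'D_xi f z| <= Q * norm_W1infty f.
Proof.
move=> Cf cK fK P1 KP Q0 sx.
have [B HB] := sasaki_derive_bounded Cf cK fK P1 KP.
have df : differentiable f z by case: (Cf z I).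
have sx1 : sasaki z (Q^-1 *: xi) (Q^-1 *: xi) <= 1.
  by rewrite sasakiZ exprVn ler_pdivrMl ?exprn_gt0// mulr1.
have inner : `|'D_(Q^-1 *: xi) f z| <= sasaki_dnorm f z.
  apply: ub_le_sup; last by exists (Q^-1 *: xi).
  by exists B => _ [eta /= es <-]; exact: HB.
have outer : sasaki_dnorm f z <= sup (range (sasaki_dnorm f)).
  apply: ub_le_sup; last by exists z.
  exists B => _ [q _ <-]; apply: ge_sup => [|_ [eta /= es <-]]; last exact: HB.
  exists `|'D_(0 *: xi) f q|; exists (0 *: xi) => //=.
  by rewrite sasakiZ expr0n mul0r ler01.
rewrite -ler_pdivrMl//.
rewrite deriveZ_dir// normrM gtr0_norm ?invr_gt0// in inner.
apply: (le_trans inner); apply: (le_trans outer).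
by rewrite lerDr; apply: le_trans (le_norm_Linfty z Cf cK fK).
Qed.

End Estimates.

(** * The spatial density as a fibre integral *)

Section Density.
Variable R : realType.
Local Notation mu2 := (@lebesgue_measure R \x @lebesgue_measure R)%E.
Implicit Types (x y u v w e : R * R) (z q : (R * R) * (R * R)) (a s t r th : R).

Lemma vol_densityE x : vol_density x = (height x)^-1.
Proof.
have N : 1 + dot x x != 0 by rewrite gt_eqF// ltr_pwDl// dot_ge0.
rewrite /vol_density.
have -> : gH x (1, 0) (1, 0) * gH x (0, 1) (0, 1) - gH x (1, 0) (0, 1) ^+ 2 =
    (1 + dot x x)^-1.
  rewrite gH_gram height_sqr /cross /=.
  by rewrite mulr1 mulr0 subr0 expr1n mul1r.
by rewrite -height_sqr -exprVn sqrtr_sqr ger0_norm// invr_ge0 ltW// height_gt0.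
Qed.

Lemma height_polar r th : height (polar r th) = cosh r.
Proof.
by apply: height_uniq; [exact: cosh_gt0|rewrite dot_polar cosh2_sinh2].
Qed.

Section Fiber.
Variables (F : (R * R) * (R * R) -> R) (x : R * R) (P : R).
Hypothesis CF : C1 setT F.
Hypothesis FP : forall y v, P * height y < `|v| -> F (y, v) = 0.

(** The radius P y0 depends continuously on the base point, so F vanishes on a
    neighbourhood of (x, v) and horizontal derivatives vanish too. *)
Lemma fiber_derive0 v (d : (R * R) * (R * R)) :
  P * height x < `|v| -> 'D_d F (x, v) = 0.
Proof.
move=> xv; apply: derive_near0.
have ch : continuous (fun z : (R * R) * (R * R) => `|z.2| - P * height z.1).
  have c1 : continuous (fun z : (R * R) * (R * R) => z.1) by move=> z; exact: cvg_fst.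
  have c2 : continuous (fun z : (R * R) * (R * R) => z.2) by move=> z; exact: cvg_snd.
  have cn : continuous (fun v : R * R => `|v|) by move=> w; exact: norm_continuous.
  have cd := continuous_compT (continuous_pair c1 c1) (@continuous_dot2 R).
  move=> z; apply: cvgB; first exact: (continuous_compT c2 cn).
  apply: cvgM; first exact: cvg_cst.
  have cs : continuous (fun z : (R * R) * (R * R) => 1 + dot z.1 z.1).
    by move=> w; apply: cvgD; [exact: cvg_cst|exact: cd].
  exact: (continuous_compT cs (@sqrt_continuous R)).
have : \forall z \near (x, v), 0 < `|z.2| - P * height z.1.
  by apply: (cvgr_gt _ (ch (x, v))); rewrite subr_gt0.
by apply: filterS => -[y w] /=; rewrite subr_gt0 => /FP.
Qed.

Lemma C1_fiber : C1 setT (fun v => F (x, v)).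
Proof.
move=> v _.
have S k b := @derive_slice _ _ _ F x k b (@CF (x, k) I).1.
split=> [|b]; first by have [] := S v 0.
have -> : (fun k => 'D_b (fun v => F (x, v)) k) = (fun k => 'D_(0, b) F (x, k)).
  by apply/funext => k; have [_] := S k b.
apply: (@continuous_compT _ _ _ (fun k => (x, k)) (fun z => 'D_(0, b) F z)).
  by apply: continuous_pair => k; [exact: cvg_cst|exact: cvg_id].
exact: C1_derive_continuous.
Qed.

Lemma integrable_fiber : mu2.-integrable setT (EFin \o (fun v => F (x, v))).
Proof.
apply: (@integrable_compact_support _ _ (P * height x)); last by move=> v /FP.
exact: (C1_continuous C1_fiber).
Qed.

Lemma rho_fiber : rho F x = (height x)^-1 * \int[mu2]_v F (x, v).
Proof.
rewrite /rho vol_densityE.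
rewrite -[RHS]RintegralZl//; last exact: integrable_fiber.
by apply: eq_Rintegral => v _; rewrite mulrC.
Qed.

Lemma continuous_fiber_derive (a b : R * R) :
  continuous (fun v => 'D_(a, b) F (x, v)).
Proof.
apply: (@continuous_compT _ _ _ (fun k => (x, k)) (fun z => 'D_(a, b) F z)).
  by apply: continuous_pair => k; [exact: cvg_cst|exact: cvg_id].
exact: C1_derive_continuous.
Qed.

Lemma integrable_fiber_derive (a : R * R) :
  mu2.-integrable setT (EFin \o (fun v => 'D_(a, 0) F (x, v))).
Proof.
apply: (@integrable_compact_support _ _ (P * height x)).
  exact: continuous_fiber_derive.
by move=> v; exact: fiber_derive0.
Qed.

(** The fibre component of the lifted boost is (dot x v / y0) e, a field of the
    form treated in [Rintegral_by_parts_dot]. *)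
Lemma derive_boostE e v : 'D_(boost e (x, v)) F (x, v) =
  'D_(height x *: e, 0) F (x, v) + (height x)^-1 * (dot x v * 'D_e (fun v => F (x, v)) v).
Proof.
have dF : differentiable F (x, v) by case: (@CF (x, v) I).
have [_ ->] := @derive_slice _ _ _ F x v e dF.
have -> : boost e (x, v) = 1 *: (height x *: e, 0) + height_rate (x, v) *: (0, e).
  rewrite /boost /= scale1r.
  by apply/pair_equal_spec; rewrite /= scaler0 addr0 add0r.
have -> := derive_comb 1 (height_rate (x, v)) (height x *: e, 0) (0, e) dF.
by rewrite mul1r mulrA /height_rate/= (mulrC (dot x v)).
Qed.

Lemma continuous_boost_derive e : continuous (fun v => 'D_(boost e (x, v)) F (x, v)).
Proof.
have -> : (fun v => 'D_(boost e (x, v)) F (x, v)) =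
  (fun v => 'D_(height x *: e, 0) F (x, v)
    + (height x)^-1 * (dot x v * 'D_e (fun v => F (x, v)) v)).
  by apply/funext => v; exact: derive_boostE.
have cD := @C1_derive_continuous _ _ _ e C1_fiber.
move=> v; apply: cvgD; first exact: continuous_fiber_derive.
apply: cvgM; first exact: cvg_cst.
by apply: cvgM; [exact: continuous_dot|exact: cD].
Qed.

(** The last term comes from integrating the fibre component by parts.  It is
    cancelled by the derivative of the volume density 1 / y0 when the density
    is differentiated along a boost. *)
Lemma Rintegral_boost e :
  \int[mu2]_v 'D_(boost e (x, v)) F (x, v) =
  \int[mu2]_v 'D_(height x *: e, 0) F (x, v)
  - (height x)^-1 * (dot x e * \int[mu2]_v F (x, v)).
Proof.
transitivity (\int[mu2]_v ('D_(height x *: e, 0) F (x, v)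
    + (height x)^-1 * (dot x v * 'D_e (fun v => F (x, v)) v))).
  by apply: eq_Rintegral => v _; exact: derive_boostE.
have cD := @C1_derive_continuous _ _ _ e C1_fiber.
have iD : mu2.-integrable setT (EFin \o (fun v => dot x v * 'D_e (fun v => F (x, v)) v)).
  apply: (@integrable_compact_support _ _ (P * height x)).
    by move=> v; apply: cvgM; [exact: continuous_dot|exact: cD].
  by move=> v Nv; rewrite (derive_beyond_radius0 _ (@FP x) Nv) mulr0.
have iH := integrable_fiber_derive (height x *: e).
have iD' : mu2.-integrable setT
    (EFin \o (fun v => (height x)^-1 * (dot x v * 'D_e (fun v => F (x, v)) v))).
  have := integrableZl measurableT (height x)^-1 iD.
  by apply: eq_integrable => //= v _; rewrite EFinM.
rewrite RintegralD// RintegralZl// (Rintegral_by_parts_dot _ _ C1_fiber (@FP x)).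
by rewrite mulrN.
Qed.

Lemma Rintegral_fiber_derive e (c : R) :
  \int[mu2]_v 'D_(c *: (height x *: e), 0) F (x, v) =
  c * (\int[mu2]_v 'D_(boost e (x, v)) F (x, v)
       + (height x)^-1 * (dot x e * \int[mu2]_v F (x, v))).
Proof.
have J := esym (canLR (subrK _) (Rintegral_boost e)).
apply: etrans (congr1 (fun k => c * k) J).
have iD := integrable_fiber_derive (height x *: e).
apply: etrans (RintegralZl c measurableT iD).
apply: eq_Rintegral => v _.
have dF : differentiable F (x, v) by case: (@CF (x, v) I).
have -> : (c *: (height x *: e), 0) = c *: (height x *: e, 0) :> (R * R) * (R * R).
  by apply/pair_equal_spec; rewrite /= scaler0.
exact: deriveZ_dir.
Qed.

End Fiber.
End Density.

(** * Decay of the density and of its derivatives *)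

Section Decay.
Variable R : realType.
Local Notation mu2 := (@lebesgue_measure R \x @lebesgue_measure R)%E.
Implicit Types (x y u v w e : R * R) (z q : (R * R) * (R * R)) (a s t r th : R).

Variables (alpha P : R) (K : set ((R * R) * (R * R))).
Hypotheses (alpha0 : 0 < alpha) (cK : compact K) (KR : K `<=` region alpha).
Hypotheses (P1 : 1 <= P)
  (KP : forall q, K q -> height q.1 <= P /\ dot q.2 q.2 <= P ^+ 2).

(** Each factor 1 / y0 is O(exp(- alpha t)) on the base points reached from K,
    while the fibre integral itself stays bounded.  The exponent n is 1 for the
    density and its radial derivative, 2 for its angular derivative. *)
Lemma fiber_decay (g : R * R -> R) t x M n : 0 <= t -> 0 <= M ->
  continuous g -> (forall v, `|g v| <= M) ->
  (forall v, g v != 0 -> K (flow (- t) (x, v))) ->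
  (height x)^-1 ^+ n * `|\int[mu2]_v g v|
    <= (4 * P / expR (alpha * t)) ^+ n * (16 * P ^+ 3 * M).
Proof.
move=> t0 M0 cg gM gK.
have P0 : 0 < P := lt_le_trans ltr01 P1.
have hx := height_gt0 x; have E0 := expR_gt0 (alpha * t).
have B0 : 0 <= 4 * P / expR (alpha * t) by rewrite divr_ge0 ?expR_ge0// mulr_ge0// ltW.
have [[v gv]|ng] := pselect (exists v, g v != 0); last first.
  have g0 v : g v = 0 by apply/eqP/negPn/negP => gv; apply: ng; exists v.
  rewrite /Rintegral integral0_eq => [|v _]; last by rewrite g0.
  rewrite normr0 mulr0; apply: mulr_ge0; first exact: exprn_ge0.
  by apply: mulr_ge0 => //; apply: mulr_ge0 => //; rewrite exprn_ge0// ltW.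
apply: ler_pM => //; first by rewrite exprn_ge0// invr_ge0 ltW.
  have [_ _ Eh] := support_bound alpha0 KR P1 t0 KP (gK _ gv).
  apply: lerXn2r; rewrite ?qualifE//=; first by rewrite invr_ge0 ltW.
  by rewrite ler_pdivlMr// ler_pdivrMl// [leRHS]mulrC.
apply: (@Rintegral_fiber_le _ g x) => // w gw.
by have [] := support_bound alpha0 KR P1 t0 KP (gK _ gw).
Qed.

Variables (f0 : (R * R) * (R * R) -> R) (f : R -> (R * R) * (R * R) -> R).
Hypotheses (C0 : C1 setT f0) (f0K : supp f0 = K) (sol : vlasov_solution f0 f).

Lemma solution_support t z : 0 <= t -> f t z != 0 -> K (flow (- t) z).
Proof.
move=> t0; rewrite (vlasov_characteristics z sol t0) -f0K => fz.
exact: subset_closure.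
Qed.

Lemma solution_beyond_radius0 t y v : 0 <= t -> P * height y < `|v| -> f t (y, v) = 0.
Proof.
move=> t0 yv; apply/eqP; apply: contraT => /(solution_support t0) Kq.
have [H _ _] := support_bound alpha0 KR P1 t0 KP Kq.
have P0 : 0 <= P := le_trans ler01 P1.
by have := fiber_support_norm P0 H; rewrite leNgt yv.
Qed.

(** If the image is off K, the derivative at a moving phase point is that of f0
    off its support, hence zero.  Phase points of zero speed are treated
    separately, as the flow is not differentiable there: f vanishes at speeds
    below alpha. *)
Lemma boost_derive_support e t z : 0 <= t ->
  'D_(boost e z) (f t) z != 0 -> K (flow (- t) z).
Proof.
move=> t0 Dz; apply: contrapT => nK; case/negP: Dz; apply/eqP.
have Cf := vlasov_slice_C1 C0 sol t0.
have [g0|g0] := ltP 0 (gH z.1 z.2 z.2).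
  rewrite (@boost_invariance _ f0 _ _ _ (- t)) //.
  - by rewrite derive_supp// f0K.
  - by move=> p; exact: vlasov_characteristics.
  - by case: (Cf z I).
  - by case: (@C0 (flow (- t) z) I).
apply: derive_near0.
have : \forall q \near z, gH q.1 q.2 q.2 < alpha ^+ 2.
  apply: (cvgr_lt _ (@continuous_gH R z)).
  by rewrite (le_lt_trans g0)// exprn_gt0.
apply: filterS => q qa; apply/eqP; apply: contraT => /(solution_support t0) Kq.
have : alpha ^+ 2 <= speed (flow (- t) q) ^+ 2 by rewrite speed_sqr; exact: KR.
by rewrite flow_speed speed_sqr leNgt qa.
Qed.

Lemma boost_derive_le e t z : dot e e = 1 -> 0 <= t ->
  `|'D_(boost e z) (f t) z| <= 4 * P ^+ 3 * norm_W1infty f0.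
Proof.
move=> e1 t0; have Cf := vlasov_slice_C1 C0 sol t0.
have P0 : 0 < P := lt_le_trans ltr01 P1.
have Q0 : 0 < 4 * P ^+ 3 by rewrite mulr_gt0// exprn_gt0.
have [Kq|nK] := pselect (K (flow (- t) z)); last first.
  have [->|] := eqVneq ('D_(boost e z) (f t) z) 0; last by move/(boost_derive_support t0).
  rewrite normr0; apply: (@le_trans _ _ `|'D_0 f0 z|) => //.
  apply: (derive_le_W1infty C0 cK f0K P1 KP Q0).
  by rewrite -(scale0r z) sasakiZ expr0n mul0r sqr_ge0.
have [hP vP] := KP Kq.
rewrite (@boost_invariance _ f0 _ _ _ (- t)).
- apply: (derive_le_W1infty C0 cK f0K P1 KP Q0).
  exact: sasaki_boost_le.
- by move=> p; exact: vlasov_characteristics.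
- by case: (Cf z I).
- by case: (@C0 (flow (- t) z) I).
- rewrite -speed_sqr -(flow_speed (- t)) speed_sqr.
  by apply: lt_le_trans (KR Kq); rewrite exprn_gt0.
Qed.

Lemma rho_decay t x : 0 <= t ->
  `|rho (f t) x| <= 4 * P / expR (alpha * t) * (16 * P ^+ 3 * norm_Linfty f0).
Proof.
move=> t0; have Cf := vlasov_slice_C1 C0 sol t0.
rewrite (rho_fiber _ Cf (fun y v => @solution_beyond_radius0 t y v t0)).
rewrite normrM ger0_norm; last by rewrite invr_ge0 ltW// height_gt0.
rewrite -[X in X * _ <= _]expr1 -[X in _ <= X * _]expr1.
apply: fiber_decay => //.
- by apply: le_trans (le_norm_Linfty ((0, 0), (0, 0)) C0 cK f0K).
- exact: (C1_continuous (C1_fiber x Cf)).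
- by move=> v; rewrite (vlasov_characteristics _ sol t0); exact: le_norm_Linfty C0 cK f0K.
- by move=> v; exact: solution_support.
Qed.

Lemma boost_integral_decay t x e n : 0 <= t -> dot e e = 1 ->
  (height x)^-1 ^+ n * `|\int[mu2]_v 'D_(boost e (x, v)) (f t) (x, v)|
    <= (4 * P / expR (alpha * t)) ^+ n
       * (16 * P ^+ 3 * (4 * P ^+ 3 * norm_W1infty f0)).
Proof.
move=> t0 e1; have Cf := vlasov_slice_C1 C0 sol t0.
have B z := boost_derive_le z e1 t0.
apply: fiber_decay => //.
- by apply: le_trans (B ((0, 0), (0, 0))).
- exact: (@continuous_boost_derive _ (f t) x Cf).
- by move=> v; exact: boost_derive_support.
Qed.

Lemma is_derive_polar_dth r th :
  is_derive th 1 (fun h => polar r h) (polar_dth r th).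
Proof.
rewrite /polar /polar_dth; apply: is_derive_pair.
have := @is_deriveZ _ _ _ (@cos R) (sinh r) _ _ _ (is_derive_cos th).
by move=> H; apply: (is_derive_eq H); rewrite scalerN.
Qed.

Lemma is_derive_polar_dr r th :
  is_derive r 1 (fun h => polar h th) (polar_dr r th).
Proof.
have ds := is_derive_sinh r.
have S (c : R) : is_derive r 1 (fun h => sinh h * c) (cosh r * c).
  have := is_deriveM ds (is_derive_cst c r (1 : R)).
  by move=> H; apply: (is_derive_eq H); rewrite scaler0 add0r /GRing.scale/= mulrC.
by rewrite /polar /polar_dr; apply: is_derive_pair.
Qed.

Lemma continuous_polar_dth r : continuous (polar_dth r).
Proof.
apply: continuous_pair => h.
  by apply: cvgN; apply: cvgM; [exact: cvg_cst|exact: continuous_sin].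
by apply: cvgM; [exact: cvg_cst|exact: continuous_cos].
Qed.

Lemma continuous_polar_dr th : continuous (fun r => polar_dr r th).
Proof.
have cc : continuous (@cosh R).
  by move=> h; apply/differentiable_continuous/derivable1_diffP; case: (is_derive_cosh h).
apply: continuous_pair => h; apply: cvgM; [exact: cc|exact: cvg_cst|exact: cc|exact: cvg_cst].
Qed.

(** The tangent of the circle is sinh r / y0 times the boost field in the
    direction e, and e is orthogonal to the point, so the correction term of
    [Rintegral_boost] vanishes. *)
Lemma rho_derive_th t r th (e := (- sin th, cos th)) : 0 <= t ->
  is_derive th 1 (fun h => rho (f t) (polar r h))
    (sinh r * ((height (polar r th))^-1 ^+ 2 *
       \int[mu2]_v 'D_(boost e (polar r th, v)) (f t) (polar r th, v))).
Proof.
move=> t0; have Cf := vlasov_slice_C1 C0 sol t0.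
have FP y v := @solution_beyond_radius0 t y v t0.
have -> : (fun h => rho (f t) (polar r h)) =
    (fun h => (cosh r)^-1 * \int[mu2]_v f t (polar r h, v)).
  by apply/funext => h; rewrite (rho_fiber _ Cf FP) height_polar.
have := @is_derive_Rintegral_along _ (f t) (polar r) (polar_dth r) th (P * cosh r) Cf
  (is_derive_polar_dth r) (@continuous_polar_dth r) _.
move=> /(_ _)/wrap[].
  by move=> h v _; rewrite -(height_polar r h); exact: FP.
move=> dI; have := @is_deriveZ _ _ _ _ (cosh r)^-1 _ _ _ dI.
move=> H; apply: (is_derive_eq H).
have hE := height_polar r th; have h0 : cosh r != 0 by rewrite gt_eqF// cosh_gt0.
have -> : polar_dth r th = (sinh r / cosh r) *: (height (polar r th) *: e).
  rewrite hE scalerA divfK// /polar_dth /e.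
  by apply/pair_equal_spec; rewrite /= /GRing.scale/= mulrN.
have J := Rintegral_fiber_derive (polar r th) Cf FP e (sinh r / cosh r).
apply: (etrans (congr1 (fun k => (cosh r)^-1 * k) J)).
have -> : dot (polar r th) e = 0 by rewrite /dot /polar /e /=; ring.
rewrite mul0r mulr0 addr0 hE.
have A (c b k : R) : c^-1 * (b / c * k) = b * (c^-1 ^+ 2 * k) by ring.
exact: A.
Qed.

(** The tangent of the ray is the boost field in the direction of the point; the
    correction term of [Rintegral_boost] cancels the derivative of 1 / cosh r. *)
Lemma rho_derive_r t r th (e := (cos th, sin th)) : 0 <= t ->
  is_derive r 1 (fun h => rho (f t) (polar h th))
    ((height (polar r th))^-1 ^+ 1 *
       \int[mu2]_v 'D_(boost e (polar r th, v)) (f t) (polar r th, v)).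
Proof.
move=> t0; have Cf := vlasov_slice_C1 C0 sol t0.
have FP y v := @solution_beyond_radius0 t y v t0.
have P0 : 0 <= P := le_trans ler01 P1.
have -> : (fun h => rho (f t) (polar h th)) =
    (fun h => (cosh h)^-1) * (fun h => \int[mu2]_v f t (polar h th, v)).
  by apply/funext => h; rewrite (rho_fiber _ Cf FP) height_polar.
have := @is_derive_Rintegral_along _ (f t) (fun h => polar h th) (fun h => polar_dr h th)
  r (P * (expR (r + 1) + expR (1 - r))) Cf
  (fun h => is_derive_polar_dr h th) (@continuous_polar_dr th) _.
move=> /(_ _)/wrap[].
  move=> h v; rewrite ltr_norml => /andP[h1 h2] L; apply: FP.
  apply: le_lt_trans L; rewrite height_polar ler_wpM2l//.
  rewrite /cosh ler_pdivrMr// mulr_natr mulr2n.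
  have : expR h <= expR (r + 1) by rewrite ler_expR; lra.
  have : expR (- h) <= expR (1 - r) by rewrite ler_expR; lra.
  have := expR_ge0 (r + 1); have := expR_ge0 (1 - r); lra.
move=> dI.
have hE := height_polar r th; have h0 : cosh r != 0 by rewrite gt_eqF// cosh_gt0.
have dV : is_derive r 1 (fun h => (cosh h)^-1) (- (cosh r) ^- 2 *: sinh r).
  have [d1 d2] := is_derive_cosh r.
  apply: DeriveDef; first by apply: derivableV.
  by rewrite deriveV// d2.
have polE : polar_dr r th = 1 *: (height (polar r th) *: e).
  rewrite hE scale1r /polar_dr /e.
  by apply/pair_equal_spec.
apply: (is_derive_eq (is_deriveM dV dI)); rewrite polE.
have J := Rintegral_fiber_derive (polar r th) Cf FP e 1.
have dE : dot (polar r th) e = sinh r.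
  by rewrite /dot /polar /e /= -[RHS]mulr1 -(cos2Dsin2 th); ring.
rewrite dE hE in J *.
have A (c b k1 k2 k3 : R) : c != 0 -> k1 = 1 * (k3 + c^-1 * (b * k2)) ->
    c^-1 * k1 + k2 * (- c ^- 2 * b) = c^-1 ^+ 1 * k3.
  by move=> c0 ->; field.
exact: A h0 J.
Qed.

End Decay.

Theorem theorem1p1 (R : realType) (alpha : R) (K : set ((R * R) * (R * R))) :
  0 < alpha -> compact K -> K `<=` region alpha ->
  exists2 C : R, 0 < C &
    forall (f0 : (R * R) * (R * R) -> R) (f : R -> (R * R) * (R * R) -> R),
      C1 setT f0 -> (forall z, 0 <= f0 z) -> supp f0 = K ->
      vlasov_solution f0 f ->
      forall t : R, 0 <= t ->
        (forall x : R * R,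
           `|rho (f t) x| <= C / expR (alpha * t) * norm_Linfty f0) /\
        (forall r th : R, 0 < r ->
           [/\ derivable (fun th' => rho (f t) (polar r th')) th 1,
               derivable (fun r' => rho (f t) (polar r' th)) r 1,
               `|(sinh r)^-1 * derive1 (fun th' => rho (f t) (polar r th')) th|
                 <= C / expR (2 * alpha * t) * norm_W1infty f0 &
               `|derive1 (fun r' => rho (f t) (polar r' th)) r|
                 <= C / expR (alpha * t) * norm_W1infty f0]).
Proof.
move=> alpha0 cK KR; have [P P1 KP] := compact_phase_bound cK.
have P0 : 0 < P := lt_le_trans ltr01 P1.
have Pm m n : (m <= n)%N -> P ^+ m <= P ^+ n by move=> mn; rewrite ler_weXn2l.
(* 16 P^3 bounds the area, 4 P^3 the Sasaki norm of the boost field on K, and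
   each factor 1 / y0 contributes 4 P: the angular estimate has the largest
   constant, (4 P)^2 * 16 P^3 * 4 P^3. *)
exists (1024 * P ^+ 8).
  by apply: mulr_gt0; [rewrite ltr0n|exact: exprn_gt0].
move=> f0 f C0 _ f0K sol t t0.
have L0 : 0 <= norm_Linfty f0.
  exact: le_trans (normr_ge0 _) (le_norm_Linfty ((0, 0), (0, 0)) C0 cK f0K).
have W0 : 0 <= norm_W1infty f0.
  have z0 : ((0, 0), (0, 0)) = 0 *: ((0, 0), (0, 0)) :> (R * R) * (R * R).
    by rewrite scale0r.
  have := derive_le_W1infty (z := 0) (xi := 0 *: 0) C0 cK f0K P1 KP ltr01.
  rewrite sasakiZ expr0n mul0r expr1n ler01 mul1r => /(_ isT).
  exact: le_trans.
set E := expR (alpha * t); have E0 : 0 < E := expR_gt0 _.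
have E2 : expR (2 * alpha * t) = E ^+ 2.
  by rewrite -mulrA mulr_natl mulr2n expRD.
have C4 : 64 * P ^+ 4 <= 1024 * P ^+ 8.
  by apply: ler_pM (Pm 4%N 8%N isT); rewrite ?ler_nat// exprn_ge0// ltW.
have C7 : 256 * P ^+ 7 <= 1024 * P ^+ 8.
  by apply: ler_pM (Pm 7%N 8%N isT); rewrite ?ler_nat// exprn_ge0// ltW.
split=> [x|r th r0].
  apply: (le_trans (rho_decay alpha0 cK KR P1 KP C0 f0K sol x t0)).
  rewrite -/E.
  have -> : 4 * P / E * (16 * P ^+ 3 * norm_Linfty f0) =
    (64 * P ^+ 4) / E * norm_Linfty f0 by ring.
  by apply: ler_wpM2r => //; apply: ler_wpM2r C4; rewrite invr_ge0 ltW.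
have [dth Eth] := rho_derive_th alpha0 KR P1 KP C0 f0K sol r th t0.
have [dr Er] := rho_derive_r alpha0 KR P1 KP C0 f0K sol r th t0.
have U1 : dot (- sin th, cos th) (- sin th, cos th) = 1.
  by rewrite /dot/= mulrNN -!expr2 addrC cos2Dsin2.
have U2 : dot (cos th, sin th) (cos th, sin th) = 1.
  by rewrite /dot/= -!expr2 cos2Dsin2.
have hx : 0 <= (height (polar r th))^-1 by rewrite invr_ge0 ltW// height_gt0.
split; [exact: dth|exact: dr| |].
- have S0 := lt0r_neq0 (sinh_gt0 r0).
  rewrite derive1E Eth (mulKf S0) normrM (ger0_norm (exprn_ge0 _ hx)).
  apply: (le_trans (boost_integral_decay alpha0 cK KR P1 KP C0 f0K sol _ _ t0 U1)).
  rewrite -/E E2.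
  have -> : (4 * P / E) ^+ 2 * (16 * P ^+ 3 * (4 * P ^+ 3 * norm_W1infty f0)) =
    (1024 * P ^+ 8) / E ^+ 2 * norm_W1infty f0 by field; rewrite gt_eqF.
  by [].
- rewrite derive1E Er.
  rewrite normrM (ger0_norm (exprn_ge0 _ hx)).
  apply: (le_trans (boost_integral_decay alpha0 cK KR P1 KP C0 f0K sol _ _ t0 U2)).
  rewrite -/E expr1.
  have -> : 4 * P / E * (16 * P ^+ 3 * (4 * P ^+ 3 * norm_W1infty f0)) =
    (256 * P ^+ 7) / E * norm_W1infty f0 by ring.
  by apply: ler_wpM2r => //; apply: ler_wpM2r C7; rewrite invr_ge0 ltW.
Qed.
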